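(* Let $\lambda_1,\lambda_2,\lambda_3,\lambda_4\in\mathbb{C}$ be such that $\sum_{i\in I}\lambda_i\notin\frac12\mathbb{Z}_{\ge0}$ for every nonempty $I\subseteq\{1,2,3,4\}$. Let $\lambda_{23},\lambda_{24},\lambda_{123},\lambda_{124},\lambda_{1234}$ be such that $\lambda_2+\lambda_3-\lambda_{23}$, $\lambda_2+\lambda_4-\lambda_{24}$, $\lambda_1+\lambda_{23}-\lambda_{123}$, $\lambda_1+\lambda_{24}-\lambda_{124}$, $\lambda_4+\lambda_{123}-\lambda_{1234}$, $\lambda_3+\lambda_{124}-\lambda_{1234}$ all lie in $\mathbb{Z}_{\ge0}$, and put $C_I=\lambda_I(\lambda_I+1)$ for each index $I$. Then $$\sum_\alpha(-1)^{-\alpha+\lambda_2-\lambda_{23}-\lambda_{24}}q^{-\alpha(\alpha+1)+C_2-C_{23}-C_{24}}\begin{Bmatrix}\lambda_1&\lambda_2&\alpha\\ \lambda_3&\lambda_{123}&\lambda_{23}\end{Bmatrix}_q\begin{Bmatrix}\lambda_4&\alpha&\lambda_{124}\\ \lambda_3&\lambda_{1234}&\lambda_{123}\end{Bmatrix}_q\begin{Bmatrix}\lambda_4&\lambda_2&\lambda_{24}\\ \lambda_1&\lambda_{124}&\alpha\end{Bmatrix}_q$$ $$=\sum_\beta(-1)^{-\beta+\lambda_{1234}-\lambda_{123}-\lambda_{124}}q^{-\beta(\beta+1)+C_{1234}-C_{123}-C_{124}}\begin{Bmatrix}\lambda_4&\lambda_{23}&\beta\\ \lambda_1&\lambda_{1234}&\lambda_{123}\end{Bmatrix}_q\begin{Bmatrix}\lambda_4&\lambda_2&\lambda_{24}\\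 \lambda_3&\beta&\lambda_{23}\end{Bmatrix}_q\begin{Bmatrix}\lambda_1&\lambda_{24}&\lambda_{124}\\ \lambda_3&\lambda_{1234}&\beta\end{Bmatrix}_q,$$ where the left sum is over $\alpha=\lambda_1+\lambda_2-j$, $j=0,\ldots,\min\{\lambda_1+\lambda_2+\lambda_3-\lambda_{123},\ \lambda_1+\lambda_2+\lambda_4-\lambda_{124}\}$, and the right sum is over $\beta=\lambda_2+\lambda_3+\lambda_4-k$, $k=0,1,\ldots,\lambda_1+\lambda_2+\lambda_3+\lambda_4-\lambda_{1234}$.
   Context: Notation: $q=e^{h/2}$ with $h\in\mathbb{C}$, $q^x:=e^{hx/2}$, $(-1)^x:=e^{i\pi x}$ for $x\in\mathbb{C}$, $[x]_q=\frac{q^x-q^{-x}}{q-q^{-1}}$, $[n]_q!=\prod_{s=1}^n[s]_q$, $[0]_q!=1$. The parameter $q$ is generic: $[x]_q\neq0$ for every nonzero $x\in\mathbb{Z}+\sum_{i=1}^42\mathbb{Z}\lambda_i$. Terms with $[n]_q!$, $n$ a negative integer, in the denominator are omitted; empty products equal $1$. For $\mu\notin\frac12\mathbb{Z}_{\ge0}$ the Verma module $M_\mu$ of $U_q(\mathfrak{sl}_2)$ has basis $e^\mu_a$, $a\in\mu-\mathbb{Z}_{\ge0}$, with $Ke^\mu_a=q^{2a}e^\mu_a$, $Ee^\mu_a=[\mu-a]_qe^\mu_{a+1}$, $Fe^\mu_a=[\mu+a]_qe^\mu_{a-1}$; the coproduct is $\Delta E=E\otimes K+1\otimes E$, $\Delta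 F=F\otimes1+K^{-1}\otimes F$, $\Delta K=K\otimes K$. For $\mu=\mu_1+\mu_2-J$, $J\in\mathbb{Z}_{\ge0}$, the $q3j$-symbols $$\begin{bmatrix}\mu_1&\mu_2&\mu\\ a_1&a_2&a\end{bmatrix}^\psi_q=(-1)^{\frac J2+\mu_1-a_1}q^{(\mu_2^2-a_2^2)-(\mu^2-a^2)-(\mu_1-a_1)}\frac{[\mu-a]_q!\,\Delta(\mu_1,\mu_2,\mu)}{\prod_{j=1}^{\mu-a}[\mu+a+j]_q}\sum_{z+w=\mu-a}(-1)^zq^{z(\mu+a+1)}\frac{\prod_{j=1}^z[\mu_1+a_1+j]_q\prod_{j=1}^w[\mu_2+a_2+j]_q}{[z]_q![w]_q![\mu_1-a_1-z]_q![\mu_2-a_2-w]_q!}$$ ($z,w\in\mathbb{Z}_{\ge0}$, $a=a_1+a_2$; zero otherwise) are the matrix coefficients of a module embedding $M_\mu\hookrightarrow M_{\mu_1}\otimes M_{\mu_2}$. Here $\Delta(\mu_1,\mu_2,\mu)=\Big([J]_q!\prod_{j=0}^{J-1}\frac{[2\mu_1-j]_q[2\mu_2-j]_q}{[2\mu+2+j]_q}\Big)^{1/2}$ with square roots fixed once and for all so that $\Delta(\mu_1,\mu_2,\mu)=\Delta(\mu_2,\mu_1,\mu)$. $q6j$-symbols: for an ordered triple $(\mu_1,\mu_2,\mu_3)$ of weights define in $M_{\mu_1}\otimes M_{\mu_2}\otimes M_{\mu_3}$ $$e^{\mu_{12},\mu}_a=\sum_{a_1+a_2+a_3=a}\begin{bmatrix}\mu_{12}&\mu_3&\mu\\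 a_1+a_2&a_3&a\end{bmatrix}^\psi_q\begin{bmatrix}\mu_1&\mu_2&\mu_{12}\\ a_1&a_2&a_1+a_2\end{bmatrix}^\psi_qe^{\mu_1}_{a_1}\otimes e^{\mu_2}_{a_2}\otimes e^{\mu_3}_{a_3},$$ $$e^{\mu_{23},\mu}_a=\sum_{a_1+a_2+a_3=a}\begin{bmatrix}\mu_1&\mu_{23}&\mu\\ a_1&a_2+a_3&a\end{bmatrix}^\psi_q\begin{bmatrix}\mu_2&\mu_3&\mu_{23}\\ a_2&a_3&a_2+a_3\end{bmatrix}^\psi_qe^{\mu_1}_{a_1}\otimes e^{\mu_2}_{a_2}\otimes e^{\mu_3}_{a_3}$$ ($3j$-symbols being $0$ when a weight does not occur in the corresponding module). For $\mu_1+\mu_2-\mu_{12},\mu_{12}+\mu_3-\mu\in\mathbb{Z}_{\ge0}$, the $q6j$-symbols are the coefficients (independent of $a$) in $$e^{\mu_{12},\mu}_a=\sum_{\mu_{23}}\begin{Bmatrix}\mu_1&\mu_2&\mu_{12}\\ \mu_3&\mu&\mu_{23}\end{Bmatrix}_qe^{\mu_{23},\mu}_a,$$ the sum being over $\mu_{23}$ with $\mu_2+\mu_3-\mu_{23},\ \mu_1+\mu_{23}-\mu\in\mathbb{Z}_{\ge0}$. A $q6j$-symbol is $0$ if one of the four numbers $\mu_1+\mu_2-\mu_{12}$, $\mu_{12}+\mu_3-\mu$, $\mu_2+\mu_3-\mu_{23}$, $\mu_1+\mu_{23}-\mu$ is not in $\mathbb{Z}_{\ge0}$. *)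

(* Defs.v *)
From mathcomp Require Import all_boot all_order all_algebra.
From mathcomp Require Import complex finmap monalg.
From mathcomp Require Import boolp classical_sets reals.
From mathcomp Require Import sequences trigo.

Set Implicit Arguments.
Unset Strict Implicit.
Unset Printing Implicit Defensive.

Import Order.TTheory GRing.Theory Num.Theory.
Local Open Scope ring_scope.
Local Open Scope complex_scope.

Definition cexp (R : realType) (x : R[i]) : R[i] :=
  let r := expR (complex.Re x) in
  (r * cos (complex.Im x)) +i* (r * sin (complex.Im x)).

(* (-1)^x = e^{i pi x} *)
Definition m1pow (R : realType) (x : R[i]) : R[i] := cexp ('i%C * pi%:C * x).

(* q^x for q = e^{h/2} *)
Definition qpow (R : realType) (h x : R[i]) : R[i] := cexp (h * x / 2%:R).

Definition qnum (R : realType) (h x : R[i]) : R[i] :=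
  (qpow h x - qpow h (- x)) / (qpow h 1 - qpow h (- 1)).

Definition qfact (R : realType) (h : R[i]) (n : nat) : R[i] :=
  \prod_(1 <= s < n.+1) qnum h s%:R.

(* [isnat x] is membership in Z_{>=0}; then [natC x] is that natural number. *)
Definition natC (R : realType) (x : R[i]) : nat := Num.truncn (complex.Re x).
Definition isnat (R : realType) (x : R[i]) : bool := x == (natC x)%:R.

(* The radicand of Delta(mu1, mu2, mu1 + mu2 - J). *)
Definition Delta_radicand (R : realType) (h mu1 mu2 mu : R[i]) (J : nat) :
    R[i] :=
  qfact h J * \prod_(j < J)
    (qnum h (2%:R * mu1 - j%:R) * qnum h (2%:R * mu2 - j%:R)
     / qnum h (2%:R * mu + 2%:R + j%:R)).

(* A choice of the square roots Delta(mu1, mu2, mu), symmetric in mu1, mu2. *)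
Definition Delta_choice (R : realType) (h : R[i])
    (Delta : R[i] -> R[i] -> R[i] -> R[i]) : Prop :=
  (forall (mu1 mu2 : R[i]) (J : nat),
     let mu := mu1 + mu2 - J%:R in
     Delta mu1 mu2 mu ^+ 2 = Delta_radicand h mu1 mu2 mu J) /\
  (forall mu1 mu2 mu : R[i], Delta mu1 mu2 mu = Delta mu2 mu1 mu).

(* The constraints z <= mu1 - a1 and w <= mu2 - a2 in the sum are the
   convention that terms with [n]_q!, n < 0, in the denominator are omitted. *)
Definition q3j (R : realType) (h : R[i])
    (Delta : R[i] -> R[i] -> R[i] -> R[i])
    (mu1 mu2 mu a1 a2 a : R[i]) : R[i] :=
  if [&& isnat (mu1 + mu2 - mu), isnat (mu1 - a1), isnat (mu2 - a2),
         isnat (mu - a) & a == a1 + a2] then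
    let J := natC (mu1 + mu2 - mu) in
    let n1 := natC (mu1 - a1) in
    let n2 := natC (mu2 - a2) in
    let n := natC (mu - a) in
    m1pow (J%:R / 2%:R + mu1 - a1)
    * qpow h ((mu2 ^+ 2 - a2 ^+ 2) - (mu ^+ 2 - a ^+ 2) - (mu1 - a1))
    * (qfact h n * Delta mu1 mu2 mu
       / \prod_(1 <= j < n.+1) qnum h (mu + a + j%:R))
    * \sum_(z < n.+1 | (z <= n1)%N && (n - z <= n2)%N)
        (let w := (n - z)%N in
         (-1) ^+ z * qpow h (z%:R * (mu + a + 1))
         * (\prod_(1 <= j < z.+1) qnum h (mu1 + a1 + j%:R)
            * \prod_(1 <= j < w.+1) qnum h (mu2 + a2 + j%:R))
         / (qfact h z * qfact h w * qfact h (n1 - z) * qfact h (n2 - w)))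
  else 0.

(* M_{mu1} (x) M_{mu2} (x) M_{mu3} as the free module on its basis; the key
   (n1, n2, n3) stands for e^{mu1}_{a1} (x) e^{mu2}_{a2} (x) e^{mu3}_{a3} with
   a_i = mu_i - n_i. *)
Definition verma3 (R : realType) := {malg R[i] [(nat * nat * nat)%type]}.

(* [tens3_sum mu1 mu2 mu3 a f] is the sum over a1 + a2 + a3 = a, with a_i in
   mu_i - Z_{>=0}, of f a1 a2 a3 times the corresponding basis tensor. *)
Definition tens3_sum (R : realType) (mu1 mu2 mu3 a : R[i])
    (f : R[i] -> R[i] -> R[i] -> R[i]) : verma3 R :=
  if isnat (mu1 + mu2 + mu3 - a) then
    let n := natC (mu1 + mu2 + mu3 - a) in
    \sum_(n1 < n.+1) \sum_(n2 < n.+1) \sum_(n3 < n.+1 | (n1 + n2 + n3 == n)%N)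
      << f (mu1 - n1%:R) (mu2 - n2%:R) (mu3 - n3%:R)
         *g (n1 : nat, n2 : nat, n3 : nat) >>
  else 0.

Definition e12 (R : realType) (h : R[i])
    (Delta : R[i] -> R[i] -> R[i] -> R[i])
    (mu1 mu2 mu3 mu12 mu a : R[i]) : verma3 R :=
  tens3_sum mu1 mu2 mu3 a (fun a1 a2 a3 =>
    q3j h Delta mu12 mu3 mu (a1 + a2) a3 a
    * q3j h Delta mu1 mu2 mu12 a1 a2 (a1 + a2)).

Definition e23 (R : realType) (h : R[i])
    (Delta : R[i] -> R[i] -> R[i] -> R[i])
    (mu1 mu2 mu3 mu23 mu a : R[i]) : verma3 R :=
  tens3_sum mu1 mu2 mu3 a (fun a1 a2 a3 =>
    q3j h Delta mu1 mu23 mu a1 (a2 + a3) a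
    * q3j h Delta mu2 mu3 mu23 a2 a3 (a2 + a3)).

(* [c], as a function of mu23, is a family of coefficients expressing
   e^{mu12,mu}_a through the e^{mu23,mu}_a, for all weights a of M_mu at once.
   The admissible mu23 are mu2 + mu3 - k, 0 <= k <= mu1 + mu2 + mu3 - mu. *)
Definition q6j_coefs (R : realType) (h : R[i])
    (Delta : R[i] -> R[i] -> R[i] -> R[i])
    (mu1 mu2 mu12 mu3 mu : R[i]) (c : R[i] -> R[i]) : Prop :=
  forall m : nat,
    let a := mu - m%:R in
    e12 h Delta mu1 mu2 mu3 mu12 mu a =
    \sum_(k < (natC (mu1 + mu2 + mu3 - mu)).+1)
      (let mu23 := mu2 + mu3 - k%:R in
       c mu23 *: e23 h Delta mu1 mu2 mu3 mu23 mu a).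

(* The arguments are those of {mu1 mu2 mu12; mu3 mu mu23}_q read row by row. *)
Definition q6j (R : realType) (h : R[i])
    (Delta : R[i] -> R[i] -> R[i] -> R[i])
    (mu1 mu2 mu12 mu3 mu mu23 : R[i]) : R[i] :=
  if [&& isnat (mu1 + mu2 - mu12), isnat (mu12 + mu3 - mu),
         isnat (mu2 + mu3 - mu23) & isnat (mu1 + mu23 - mu)] then
    xget 0 [set x | exists2 c : R[i] -> R[i],
                      q6j_coefs h Delta mu1 mu2 mu12 mu3 mu c & x = c mu23]%classic
  else 0.

(* [x]_q <> 0 for every nonzero x in Z + sum_i 2 Z lambda_i *)
Definition generic_q (R : realType) (h : R[i]) (lam : 'I_4 -> R[i]) : Prop :=
  forall (m : int) (k : 'I_4 -> int),
    let x := m%:~R + \sum_i (2%:R * (k i)%:~R * lam i) in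
    x != 0 -> qnum h x != 0.

(* Main.v *)
(** No R-matrix is needed.  A tree of 3j-symbols satisfies a recursion coming
from the action of Delta E, so that it is determined by its components with one
chosen tensor factor at its highest weight.  On these components the 3j-symbol
of that factor is a single term, and exchanging its two arguments multiplies it
by an explicit scalar ([wt3j_flip]).  Start from the tree (4(1(23))) with the
factor 1 at its highest weight and rewrite it in the trees (((42)1)3) in two
ways: either move 1 past 2 only, or move 1 past (23), then, after regrouping,
back past ((42)3), then past (42).  The powers of q that depend on the weights
of the vector agree, and comparing coefficients gives the identity.
The regroupings go from right-nested to left-nested trees, so they use the
inverse of the matrix of 6j-symbols.  It is the transpose: up to factors that
depend on the end weights only, the 3j-symbols are orthonormal for the form
making E adjoint to F K, by the q-Vandermonde sum. *)

Require Import Defs.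
From mathcomp Require Import boolp classical_sets.
From mathcomp Require Import all_boot all_order all_algebra.
From mathcomp Require Import complex monalg reals.
From mathcomp Require Import exp trigo ring zify.

Set Implicit Arguments.
Unset Strict Implicit.
Unset Printing Implicit Defensive.

Import Order.TTheory GRing.Theory Num.Theory.
Local Open Scope ring_scope.
Local Open Scope complex_scope.

(** * Powers of q and q-numbers *)

(** The braiding is an infinite sum in E and F. On tensors with one factor at its highest weight
    only its Cartan part survives, so exchanging that factor becomes a scalar, and every 3j-symbol
    used for it has a closed form. The price is that trees are compared only on the tensors with
    factor 1 highest; that this part still separates them is the content of [W_free]. The powers of
    q in the two chains agree because [2 l1 (a2 + a3) - 2 l1 (a4 + a2 + a3) + 2 l1 (a4 + a2) = 2 l1
    a2]. Symbols and trees are functions of arbitrary complex weights, zero off the weight lattice.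
    The recursion for E then holds everywhere and the one for F everywhere except at the highest
    weight, so no boundary cases accumulate when trees are composed. Intermediate weights are
    counted down from sums of the original l's, and all sums in the two chains run over the common
    range [0..N] with [N = l1 + l2 + l3 + l4 - l1234]; the 6j-symbols vanish on the added terms. *)

Section Cexp.
Variable R : realType.
Implicit Types (x y : R[i]) (n : nat).

Lemma cexpD x y : cexp (x + y) = cexp x * cexp y.
Proof.
case: x => a b; case: y => c d; rewrite /cexp /= expRD cosD sinD.
by apply/eqP; rewrite eq_complex /=; apply/andP; split; apply/eqP; ring.
Qed.

Lemma cexp0 : cexp 0 = 1 :> R[i].
Proof. by rewrite /cexp /= expR0 cos0 sin0 mulr1 mulr0. Qed.

Lemma cexp_neq0 x : cexp x != 0.
Proof.
apply/eqP => x0; have := cexpD x (- x).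
by rewrite subrr cexp0 x0 mul0r => /eqP; rewrite oner_eq0.
Qed.

Lemma m1powD x y : m1pow (x + y) = m1pow x * m1pow y.
Proof. by rewrite /m1pow mulrDr cexpD. Qed.

Lemma m1pow0 : m1pow 0 = 1 :> R[i].
Proof. by rewrite /m1pow mulr0 cexp0. Qed.

Lemma m1pow_neq0 x : m1pow x != 0. Proof. exact: cexp_neq0. Qed.

Lemma m1pow1 : m1pow 1 = -1 :> R[i].
Proof.
rewrite /m1pow mulr1 /cexp /= !(mul0r, mulr0, mul1r, subr0, addr0, add0r).
rewrite oppr0 expR0 !mul1r cospi sinpi.
by apply/eqP; rewrite eq_complex /= oppr0 !eqxx.
Qed.

Lemma m1pow_nat n : m1pow n%:R = (-1) ^+ n :> R[i].
Proof.
by elim: n => [|n IH]; rewrite ?m1pow0 // -addn1 natrD m1powD IH m1pow1 exprD expr1.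
Qed.

Lemma m1powN x : m1pow (- x) = (m1pow x)^-1.
Proof.
apply: (mulfI (m1pow_neq0 x)); rewrite -m1powD subrr m1pow0 divff //.
exact: m1pow_neq0.
Qed.

Lemma natC_nat n : natC (n%:R : R[i]) = n.
Proof. by rewrite /natC raddfMn /= natrK. Qed.

Lemma isnat_nat n : isnat (n%:R : R[i]).
Proof. by rewrite /isnat natC_nat. Qed.

Lemma isnatP x : isnat x -> exists n, x = n%:R.
Proof. by move/eqP=> ->; exists (natC x). Qed.

Lemma natrI (m n : nat) : m%:R = n%:R :> R[i] -> m = n.
Proof. by move/eqP; rewrite eqr_nat => /eqP. Qed.

Lemma isnat_subn m n : isnat (m%:R - n%:R : R[i]) -> (n <= m)%N.
Proof.
move=> /isnatP[k /eqP]; rewrite subr_eq -natrD => /eqP/natrI ->.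
by rewrite leq_addl.
Qed.

End Cexp.

Section QNum.
Variables (R : realType) (h : R[i]).
Hypothesis q_gen : forall n : nat, qnum h n.+1%:R != 0.
Local Notation qp := (qpow h).
Local Notation br := (qnum h).
Implicit Types (x y : R[i]) (n : nat).

Lemma qpowD x y : qp (x + y) = qp x * qp y.
Proof. by rewrite /qpow !mulrDr mulrDl cexpD. Qed.

Lemma qpow0 : qp 0 = 1. Proof. by rewrite /qpow mulr0 mul0r cexp0. Qed.

Lemma qpow_neq0 x : qp x != 0. Proof. exact: cexp_neq0. Qed.

Lemma qpowN x : qp (- x) = (qp x)^-1.
Proof.
apply: (mulfI (qpow_neq0 x)); rewrite -qpowD subrr qpow0 divff //.
exact: qpow_neq0.
Qed.

Lemma qnumE x : br x = (qp x - (qp x)^-1) / (qp 1 - (qp 1)^-1).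
Proof. by rewrite /qnum !qpowN. Qed.

(** This is the denominator of [[1]_q]; division by zero gives zero, so a nonzero [[1]_q] excludes
    that the denominator vanishes. *)
Lemma qpow1_sub : qp 1 - (qp 1)^-1 != 0.
Proof.
by apply/eqP => e; have := q_gen 0; rewrite qnumE e invr0 mulr0 eqxx.
Qed.

Lemma qnum0 : br 0 = 0. Proof. by rewrite qnumE qpow0 invr1 subrr mul0r. Qed.

Lemma qnumN x : br (- x) = - br x.
Proof. by rewrite !qnumE qpowN invrK -mulNr opprB. Qed.

Lemma qnum1 : br 1 = 1. Proof. by rewrite qnumE divff // qpow1_sub. Qed.

(** The q-Pascal splitting. Applied to [[z + w]_q] inside a sum over z + w = n + 1, it produces two
    sums over z + w = n. *)
Lemma qnumD x y : br (x + y) = qp y * br x + qp (- x) * br y.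
Proof.
have := qpow1_sub; have := qpow_neq0 x; have := qpow_neq0 y.
have := qpow_neq0 1; rewrite !qnumE qpowN qpowD.
move: (qp 1) (qp x) (qp y) => u a b u0 b0 a0 d0; field.
rewrite u0 a0 b0 /= andbT; apply: contraNneq d0 => e.
have -> : u - u^-1 = (u * u - 1) / u by field.
by rewrite e mul0r.
Qed.

(** With x = mu - a and y = mu + a this is [EF - FE = [2a]_q] on a basis vector of a Verma module:
    the products are the eigenvalues of FE and of EF. *)
Lemma qnum_swap x y : br x * br (y + 1) + br (y - x) = br (x + 1) * br y.
Proof.
rewrite (qnumD y 1) (qnumD x 1) (qnumD y) qnumN qnum1 !qpowN.
have -> : br y = (qp y - (qp y)^-1) / (qp 1 - (qp 1)^-1) by rewrite qnumE.
have -> : br x = (qp x - (qp x)^-1) / (qp 1 - (qp 1)^-1) by rewrite qnumE.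
have := qpow1_sub; have := qpow_neq0 x; have := qpow_neq0 y.
have := qpow_neq0 1.
move: (qp 1) (qp x) (qp y) => u a b u0 b0 a0 d0; field.
rewrite u0 a0 b0 /= andbT; apply: contraNneq d0 => e.
have -> : u - u^-1 = (u * u - 1) / u by field.
by rewrite e mul0r.
Qed.

Lemma qfact0 : qfact h 0 = 1. Proof. by rewrite /qfact big_nil. Qed.

Lemma qfactS n : qfact h n.+1 = qfact h n * br n.+1%:R.
Proof. by rewrite /qfact big_nat_recr. Qed.

Lemma qfact_neq0 n : qfact h n != 0.
Proof.
by elim: n => [|n IH]; rewrite ?qfact0 ?oner_eq0 // qfactS mulf_neq0.
Qed.

End QNum.

(** * The 3j-symbols as functions of all complex weights *)

(** The numbers [[2x - n]_q] are the coefficients of F on the basis of the Verma module of highest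
    weight x, so F annihilates no basis vector. The condition persists when x is lowered by a
    natural number, hence holds for all intermediate weights. *)
Definition generic_weight (R : realType) (h x : R[i]) : Prop :=
  forall n : nat, qnum h (2%:R * x - n%:R) != 0.

Section ThreeJ.
Variables (R : realType) (h : R[i]) (Delta : R[i] -> R[i] -> R[i] -> R[i]).
Hypothesis q_gen : forall n : nat, qnum h n.+1%:R != 0.
Local Notation qp := (qpow h).
Local Notation br := (qnum h).
Implicit Types (x y mu a : R[i]) (n : nat).

Definition qrise x n : R[i] := \prod_(1 <= j < n.+1) br (x + j%:R).

Lemma qrise0 x : qrise x 0 = 1. Proof. by rewrite /qrise big_nil. Qed.

Lemma qriseS x n : qrise x n.+1 = br (x + 1) * qrise (x + 1) n.
Proof.
rewrite /qrise big_nat_recl //; congr (_ * _).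
by apply: eq_bigr => i _; rewrite -[i.+1]addn1 natrD addrA addrAC.
Qed.

Lemma qrise_neq0 mu n : generic_weight h mu -> qrise (2%:R * mu - n%:R) n != 0.
Proof.
move=> g; rewrite /qrise big_nat; elim/big_ind: _ => [|x y x0 y0|i].
- exact: oner_neq0.
- exact: mulf_neq0.
rewrite ltnS => /andP[_ le_in].
suff -> : 2%:R * mu - n%:R + i%:R = 2%:R * mu - (n - i)%N%:R by exact: g.
by rewrite natrB //; ring.
Qed.

(** Fixing the total weight to be a1 + a2 leaves only lattice conditions, under whose failure the
    value is 0; recursions can thus be stated for all complex a1, a2. *)
Definition wt3j mu1 mu2 mu a1 a2 : R[i] :=
  q3j h Delta mu1 mu2 mu a1 a2 (a1 + a2).
Local Notation G := wt3j.

(* [1 / [m - z]_q!], read as [0] when [m < z]. *)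
Definition qrfact (m z : nat) : R[i] :=
  if (z <= m)%N then (qfact h (m - z))^-1 else 0.

Definition sum3j mu1 mu2 mu n (n1 n2 : nat) : R[i] :=
  \sum_(z < n.+1)
    (-1) ^+ z * qp (z%:R * (2%:R * mu - n%:R + 1))
    * (qrise (2%:R * mu1 - n1%:R) z * qrise (2%:R * mu2 - n2%:R) (n - z))
    / (qfact h z * qfact h (n - z)) * (qrfact n1 z * qrfact n2 (n - z)).

(** Weights are replaced by depths below the highest weights. The explicit evaluations of 3j-symbols
    start from this form. *)
Lemma wt3j_nat mu1 mu2 mu J n n1 n2 :
  mu = mu1 + mu2 - J%:R -> (n1 + n2 = n + J)%N ->
  G mu1 mu2 mu (mu1 - n1%:R) (mu2 - n2%:R) =
  (-1) ^+ n1 * m1pow (J%:R / 2%:R)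
  * qp (2%:R * mu2 * n2%:R - n2%:R ^+ 2 - 2%:R * mu * n%:R + n%:R ^+ 2
        - n1%:R)
  * (qfact h n * Delta mu1 mu2 mu / qrise (2%:R * mu - n%:R) n)
  * sum3j mu1 mu2 mu n n1 n2.
Proof.
move=> Emu nn.
have nnR : n1%:R + n2%:R = n%:R + J%:R :> R[i] by rewrite -!natrD nn.
have ea : mu1 - n1%:R + (mu2 - n2%:R) = mu - n%:R.
  have -> : n2%:R = n%:R + J%:R - n1%:R :> R[i] by rewrite -nnR; ring.
  by rewrite Emu; ring.
rewrite /wt3j /q3j ea.
have -> : mu1 + mu2 - mu = J%:R by rewrite Emu; ring.
have -> : mu1 - (mu1 - n1%:R) = n1%:R by ring.
have -> : mu2 - (mu2 - n2%:R) = n2%:R by ring.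
have -> : mu - (mu - n%:R) = n%:R by ring.
rewrite !isnat_nat !natC_nat eqxx /=.
congr (_ * _ * (_ * _ / _) * _).
- have -> : J%:R / 2%:R + mu1 - (mu1 - n1%:R) = n1%:R + J%:R / 2%:R by ring.
  by rewrite m1powD m1pow_nat.
- by congr qp; rewrite !expr2; ring.
- by apply: eq_bigr => j _; congr br; ring.
rewrite big_mkcond /=; apply: eq_bigr => z _.
rewrite /qrfact; case: (z <= n1)%N => /=; last by rewrite mul0r mulr0.
case: (n - z <= n2)%N => /=; last by rewrite !mulr0.
have -> : z%:R * (mu + (mu - n%:R) + 1) = z%:R * (2%:R * mu - n%:R + 1).
  by ring.
have -> : \prod_(1 <= j < z.+1) br (mu1 + (mu1 - n1%:R) + j%:R)
        = qrise (2%:R * mu1 - n1%:R) z.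
  by apply: eq_bigr => j _; congr br; ring.
have -> : \prod_(1 <= j < (n - z).+1) br (mu2 + (mu2 - n2%:R) + j%:R)
        = qrise (2%:R * mu2 - n2%:R) (n - z).
  by apply: eq_bigr => j _; congr br; ring.
by rewrite !invfM; ring.
Qed.

Lemma wt3j_eq0 mu1 mu2 mu a1 a2 :
  ~~ [&& isnat (mu1 + mu2 - mu), isnat (mu1 - a1), isnat (mu2 - a2)
      & isnat (mu - (a1 + a2))] -> G mu1 mu2 mu a1 a2 = 0.
Proof.
rewrite /wt3j /q3j eqxx andbT => nn; rewrite ifF //; exact: negbTE nn.
Qed.

Lemma wt3j_eq0J mu1 mu2 mu a1 a2 :
  ~~ isnat (mu1 + mu2 - mu) -> G mu1 mu2 mu a1 a2 = 0.
Proof. by move=> nn; rewrite wt3j_eq0 // (negbTE nn). Qed.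

Lemma wt3j_eq0l mu1 mu2 mu a1 a2 :
  ~~ isnat (mu1 - a1) -> G mu1 mu2 mu a1 a2 = 0.
Proof. by move=> nn; rewrite wt3j_eq0 // (negbTE nn) /= andbF. Qed.

Lemma wt3j_eq0r mu1 mu2 mu a1 a2 :
  ~~ isnat (mu2 - a2) -> G mu1 mu2 mu a1 a2 = 0.
Proof. by move=> nn; rewrite wt3j_eq0 // (negbTE nn) /= !andbF. Qed.

Lemma wt3j_eq0t mu1 mu2 mu a1 a2 :
  ~~ isnat (mu - (a1 + a2)) -> G mu1 mu2 mu a1 a2 = 0.
Proof. by move=> nn; rewrite wt3j_eq0 // (negbTE nn) /= !andbF. Qed.

Lemma isnatN1 n : ~~ isnat (- n.+1%:R : R[i]).
Proof.
apply/negP => /isnatP[k /eqP]; rewrite eq_sym -subr_eq0 opprK -natrD.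
by rewrite pnatr_eq0 addnS.
Qed.

(* The splitting [n + 1] = q^z [w] + q^(-w) [z], where z + w = n + 1, of the
   general term is what matches Delta F = F (x) 1 + K^-1 (x) F. *)
Lemma sum3jS mu1 mu2 mu n n1 n2 :
  br n.+1%:R * sum3j mu1 mu2 mu n.+1 n1 n2 =
  (if n2 is m.+1 then br (2%:R * mu2 - m%:R) * sum3j mu1 mu2 mu n n1 m else 0)
  - qp (2%:R * mu - 2%:R * n%:R)
    * (if n1 is m.+1 then br (2%:R * mu1 - m%:R) * sum3j mu1 mu2 mu n m n2
       else 0).
Proof.
pose g z := (-1) ^+ z * qp (z%:R * (2%:R * mu - n.+1%:R + 1))
    * (qrise (2%:R * mu1 - n1%:R) z * qrise (2%:R * mu2 - n2%:R) (n.+1 - z))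
    / (qfact h z * qfact h (n.+1 - z)) * (qrfact n1 z * qrfact n2 (n.+1 - z)).
have splitE z : (z <= n.+1)%N -> br n.+1%:R * g z =
    qp z%:R * br (n.+1 - z)%:R * g z + qp (- (n.+1 - z)%:R) * br z%:R * g z.
  move=> lez; have -> : n.+1%:R = (n.+1 - z)%:R + z%:R :> R[i].
    by rewrite -natrD subnK.
  by rewrite qnumD // mulrDl.
have -> : br n.+1%:R * sum3j mu1 mu2 mu n.+1 n1 n2 =
    \sum_(z < n.+1) qp z%:R * br (n.+1 - z)%:R * g z +
    \sum_(z < n.+1) qp (- (n - z)%:R) * br z.+1%:R * g z.+1.
  rewrite /sum3j mulr_sumr.
  rewrite (eq_bigr (fun z : 'I_n.+2 => qp z%:R * br (n.+1 - z)%:R * g z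
     + qp (- (n.+1 - z)%:R) * br z%:R * g z)); last first.
    by move=> z _; rewrite -splitE // -ltnS.
  rewrite big_split /=; congr (_ + _).
    by rewrite big_ord_recr /= subnn qnum0 mulr0 mul0r addr0.
  rewrite big_ord_recl /= qnum0 mulr0 mul0r add0r.
  by apply: eq_bigr => z _; rewrite /bump /= add1n subSS.
congr (_ + _).
- case: n2 @g splitE => [|m] g _.
    rewrite big1 // => z _; rewrite /g /qrfact.
    have -> : (n.+1 - z <= 0)%N = false.
      by rewrite leqn0 subn_eq0 leqNgt (ltn_ord z).
    by rewrite !mulr0.
  rewrite /sum3j mulr_sumr; apply: eq_bigr => z _; rewrite /g.
  have lez : (z <= n)%N by rewrite -ltnS.
  rewrite subSn // qriseS /qrfact ltnS subSS qfactS.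
  have -> : 2%:R * mu2 - m.+1%:R + 1 = 2%:R * mu2 - m%:R.
    by rewrite -natr1; ring.
  have -> : z%:R * (2%:R * mu - n%:R + 1) =
            z%:R + z%:R * (2%:R * mu - n.+1%:R + 1) :> R[i].
    by rewrite -natr1; ring.
  rewrite (qpowD h (z%:R)); set e := (if (n - z <= m)%N then _ else _).
  have b0 := q_gen (n - z).
  have fz0 := qfact_neq0 q_gen z; have fw0 := qfact_neq0 q_gen (n - z).
  by field; rewrite b0 fz0 fw0.
case: n1 @g splitE => [|m] g _.
  rewrite mulr0 oppr0 big1 // => z _; rewrite /g /qrfact ltn0.
  by rewrite mul0r !mulr0.
rewrite /sum3j !mulr_sumr -sumrN; apply: eq_bigr => z _; rewrite /g.
have lez : (z <= n)%N by rewrite -ltnS.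
rewrite subSS qriseS /qrfact ltnS subSS qfactS.
have -> : 2%:R * mu1 - m.+1%:R + 1 = 2%:R * mu1 - m%:R.
  by rewrite -natr1; ring.
have -> : z.+1%:R * (2%:R * mu - n.+1%:R + 1) = (n - z)%:R +
   (2%:R * mu - 2%:R * n%:R + z%:R * (2%:R * mu - n%:R + 1)).
  by rewrite natrB // -!natr1; ring.
rewrite (qpowD h (n - z)%:R) qpowD qpowN exprS.
set e := (if (z <= m)%N then _ else _).
have b0 := q_gen z; have p0 := qpow_neq0 h (n - z)%:R.
have fz0 := qfact_neq0 q_gen z; have fw0 := qfact_neq0 q_gen (n - z).
by field; rewrite b0 fz0 fw0 p0.
Qed.

(** The embedding commutes with F: the factor on the left is that of F on M_mu, the two terms on the
    right come from F (x) 1 and K^-1 (x) F. It is [sum3jS] once the prefactors are matched. *)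
Lemma wt3j_natF mu1 mu2 mu J n n1 n2 :
  generic_weight h mu -> mu = mu1 + mu2 - J%:R -> (n1 + n2 = n.+1 + J)%N ->
  br (2%:R * mu - n%:R) * G mu1 mu2 mu (mu1 - n1%:R) (mu2 - n2%:R) =
  (if n1 is m.+1 then
     br (2%:R * mu1 - m%:R) * G mu1 mu2 mu (mu1 - m%:R) (mu2 - n2%:R) else 0)
  + qp (- (2%:R * (mu1 - n1%:R)))
    * (if n2 is m.+1 then
         br (2%:R * mu2 - m%:R) * G mu1 mu2 mu (mu1 - n1%:R) (mu2 - m%:R)
       else 0).
Proof.
move=> g Emu nn; rewrite (wt3j_nat Emu nn).
have r0 := qrise_neq0 n g; have b0 := g n.
have fS : qrise (2%:R * mu - n.+1%:R) n.+1 =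
    br (2%:R * mu - n%:R) * qrise (2%:R * mu - n%:R) n.
  rewrite qriseS; have -> // : 2%:R * mu - n.+1%:R + 1 = 2%:R * mu - n%:R.
  by rewrite -natr1; ring.
rewrite fS qfactS.
have -> : forall A B S : R[i],
    br (2%:R * mu - n%:R) * (A * (qfact h n * br n.+1%:R * B
      / (br (2%:R * mu - n%:R) * qrise (2%:R * mu - n%:R) n)) * S)
    = A * (qfact h n * B / qrise (2%:R * mu - n%:R) n) * (br n.+1%:R * S).
  by move=> A B S; field; rewrite b0 r0.
rewrite sum3jS mulrBr addrC; congr (_ + _).
- case: n1 nn => [|m] nn; first by rewrite !mulr0 oppr0.
  have nn' : (m + n2 = n + J)%N by apply/eqP; rewrite -eqSS -addSn nn addSn.
  rewrite (wt3j_nat Emu nn') exprS.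
  have -> : 2%:R * mu2 * n2%:R - n2%:R ^+ 2 - 2%:R * mu * n%:R + n%:R ^+ 2 -
      m%:R = (2%:R * mu2 * n2%:R - n2%:R ^+ 2 - 2%:R * mu * n.+1%:R
        + n.+1%:R ^+ 2 - m.+1%:R) + (2%:R * mu - 2%:R * n%:R).
    by rewrite -!natr1 !expr2; ring.
  by rewrite (qpowD h _ (2%:R * mu - 2%:R * n%:R)); ring.
case: n2 nn => [|m] nn; first by rewrite !mulr0.
have nn' : (n1 + m = n + J)%N by apply/eqP; rewrite -eqSS -addnS nn addSn.
rewrite (wt3j_nat Emu nn').
have nnR : m%:R = n%:R + J%:R - n1%:R :> R[i].
  by rewrite -natrD -nn' natrD; ring.
have -> : 2%:R * mu2 * m.+1%:R - m.+1%:R ^+ 2 - 2%:R * mu * n.+1%:R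
        + n.+1%:R ^+ 2 - n1%:R = - (2%:R * (mu1 - n1%:R)) +
   (2%:R * mu2 * m%:R - m%:R ^+ 2 - 2%:R * mu * n%:R + n%:R ^+ 2 - n1%:R).
  by rewrite -!natr1 Emu !expr2 nnR; ring.
by rewrite qpowD; ring.
Qed.

(** The highest weight is excluded because the right side vanishes there, its symbols having total
    weight mu + 1, while the singular vector is not in the image of F. *)
Lemma wt3jF mu1 mu2 mu a1 a2 : generic_weight h mu -> a1 + a2 != mu ->
  br (mu + (a1 + a2) + 1) * G mu1 mu2 mu a1 a2 =
  br (mu1 + a1 + 1) * G mu1 mu2 mu (a1 + 1) a2
  + qp (- (2%:R * a1)) * br (mu2 + a2 + 1) * G mu1 mu2 mu a1 (a2 + 1).
Proof.
move=> g na.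
have shift (m a : R[i]) : ~~ isnat (m - a) -> ~~ isnat (m - (a + 1)).
  apply: contraNN => /isnatP[k e]; apply/eqP.
  by rewrite -[a](addrK 1) opprB addrCA e nat1r natC_nat.
have [/isnatP[J EJ]|nJ] := boolP (isnat (mu1 + mu2 - mu)); last first.
  by rewrite !(wt3j_eq0J _ _ nJ) !mulr0 addr0.
have [/isnatP[n1 E1]|n1] := boolP (isnat (mu1 - a1)); last first.
  by rewrite !wt3j_eq0l ?mulr0 ?addr0 ?shift.
have [/isnatP[n2 E2]|n2] := boolP (isnat (mu2 - a2)); last first.
  by rewrite !wt3j_eq0r ?mulr0 ?addr0 ?shift.
have [/isnatP[n En]|nn] := boolP (isnat (mu - (a1 + a2))); last first.
  rewrite !wt3j_eq0t ?mulr0 ?addr0 //.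
    by have := shift _ _ nn; rewrite addrA.
  by have := shift _ _ nn; rewrite addrAC.
have Emu : mu = mu1 + mu2 - J%:R by rewrite -EJ; ring.
have Ea1 : a1 = mu1 - n1%:R by rewrite -E1; ring.
have Ea2 : a2 = mu2 - n2%:R by rewrite -E2; ring.
have nn : (n1 + n2 = n + J)%N.
  by apply: (@natrI R); rewrite !natrD -E1 -E2 -En -EJ; ring.
case: n En nn => [|n] En nn.
  by case/eqP: na; apply/eqP; rewrite eq_sym -subr_eq0 En.
have -> : mu + (a1 + a2) + 1 = 2%:R * mu - n%:R.
  have -> : a1 + a2 = mu - n.+1%:R by rewrite -En; ring.
  by rewrite -natr1; ring.
rewrite {1}Ea1 {1}Ea2 (wt3j_natF g Emu nn) -Ea1 -Ea2 -mulrA.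
congr (_ + _ * _).
- case: n1 E1 Ea1 nn => [|m] E1 Ea1 nn.
    rewrite wt3j_eq0l ?mulr0 // Ea1 subr0 opprD addNKr; exact: (isnatN1 0).
  by rewrite Ea1 -natr1; congr (br _ * G _ _ _ _ _); ring.
case: n2 E2 Ea2 nn => [|m] E2 Ea2 nn.
  rewrite wt3j_eq0r ?mulr0 // Ea2 subr0 opprD addNKr; exact: (isnatN1 0).
by rewrite Ea2 -natr1; congr (br _ * G _ _ _ _ _); ring.
Qed.

End ThreeJ.

(* Unification would otherwise unfold these down to cosines and sines. *)
Opaque qnum qpow q3j m1pow qfact.

(** * The action of E on the 3j-symbols and the exchange of their two arguments *)

Section ThreeJ2.
Variables (R : realType) (h : R[i]) (Delta : R[i] -> R[i] -> R[i] -> R[i]).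
Hypothesis q_gen : forall n : nat, qnum h n.+1%:R != 0.
Local Notation qp := (qpow h).
Local Notation br := (qnum h).
Local Notation G := (wt3j h Delta).
Local Notation qrise := (qrise h).
Implicit Types (x y mu a : R[i]) (n : nat).

(** At total weight mu the sum has the single term z = w = 0; these are the coefficients of the
    singular vector. *)
Lemma wt3j_sing mu1 mu2 mu J n1 n2 :
  mu = mu1 + mu2 - J%:R -> (n1 + n2 = J)%N ->
  G mu1 mu2 mu (mu1 - n1%:R) (mu2 - n2%:R) =
  (-1) ^+ n1 * m1pow (J%:R / 2%:R)
  * qp (2%:R * mu2 * n2%:R - n2%:R ^+ 2 - n1%:R)
  * Delta mu1 mu2 mu / (qfact h n1 * qfact h n2).
Proof.
move=> Emu nn; rewrite (wt3j_nat h Delta (n := 0) Emu nn).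
rewrite /sum3j big_ord1 /= /qrfact !leq0n !subn0 !qrise0 !qfact0 !mul0r qpow0.
rewrite !mulr0 subr0 expr0n /= addr0 invfM expr0.
by field; rewrite !qfact_neq0.
Qed.

(** Delta E annihilates the singular vector. This starts the induction for the action of E. *)
Lemma wt3j_singE mu1 mu2 mu a1 a2 : a1 + a2 = mu + 1 ->
  br (mu1 - a1 + 1) * qp (2%:R * a2) * G mu1 mu2 mu (a1 - 1) a2
  + br (mu2 - a2 + 1) * G mu1 mu2 mu a1 (a2 - 1) = 0.
Proof.
move=> ea.
have [/isnatP[J EJ]|nJ] := boolP (isnat (mu1 + mu2 - mu)); last first.
  by rewrite !(wt3j_eq0J _ _ _ _ nJ) !mulr0 addr0.
have Emu : mu = mu1 + mu2 - J%:R by rewrite -EJ; ring.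
have [/isnatP[n1 E1]|N1] := boolP (isnat (mu1 - (a1 - 1))); last first.
  rewrite wt3j_eq0l // mulr0 add0r.
  have [/isnatP[n1 E1]|N1'] := boolP (isnat (mu1 - a1)); last first.
    by rewrite wt3j_eq0l ?mulr0.
  by case/negP: N1; rewrite opprB addrA addrAC E1 natr1 isnat_nat.
have Ea1 : a1 - 1 = mu1 - n1%:R by rewrite -E1; ring.
have [/isnatP[n2 E2]|N2] := boolP (isnat (mu2 - (a2 - 1))); last first.
  rewrite (wt3j_eq0r _ _ _ _ _ N2) mulr0 addr0.
  have [/isnatP[n2 E2]|N2'] := boolP (isnat (mu2 - a2)); last first.
    by rewrite wt3j_eq0r ?mulr0.
  by case/negP: N2; rewrite opprB addrA addrAC E2 natr1 isnat_nat.
have Ea2 : a2 - 1 = mu2 - n2%:R by rewrite -E2; ring.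
have nn : (n1 + n2 = J.+1)%N.
  apply: (@natrI R); rewrite natrD -natr1 -E1 -E2 -EJ.
  have -> : a1 = mu + 1 - a2 by rewrite -ea; ring.
  by ring.
have -> : mu1 - a1 + 1 = n1%:R by rewrite -E1; ring.
have -> : mu2 - a2 + 1 = n2%:R by rewrite -E2; ring.
case: n1 E1 Ea1 nn => [|n1] E1 Ea1 nn.
  rewrite qnum0 !mul0r add0r (@wt3j_eq0l _ _ _ _ _ _ a1) ?mulr0 //.
  have -> : mu1 - a1 = - 1%:R by rewrite -[a1](subrK 1) Ea1; ring.
  exact: (isnatN1 _ 0).
case: n2 E2 Ea2 nn => [|n2] E2 Ea2 nn.
  rewrite qnum0 mul0r addr0 (@wt3j_eq0r _ _ _ _ _ _ _ a2) ?mulr0 //.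
  have -> : mu2 - a2 = - 1%:R by rewrite -[a2](subrK 1) Ea2; ring.
  exact: (isnatN1 _ 0).
rewrite Ea1 Ea2.
have -> : a2 = mu2 - n2%:R by rewrite -[a2](subrK 1) Ea2 -natr1; ring.
have -> : a1 = mu1 - n1%:R by rewrite -[a1](subrK 1) Ea1 -natr1; ring.
rewrite (wt3j_sing Emu (n1 := n1.+1)); last by case: nn => <-; rewrite addnS.
rewrite (wt3j_sing Emu (n1 := n1)); last by case: nn => <-.
rewrite !qfactS.
have -> : 2%:R * mu2 * n2.+1%:R - n2.+1%:R ^+ 2 - n1%:R =
   2%:R * (mu2 - n2%:R) + (2%:R * mu2 * n2%:R - n2%:R ^+ 2 - n1.+1%:R).
  by rewrite -!natr1 !expr2; ring.
rewrite (qpowD h (2%:R * (mu2 - n2%:R))) (exprS (-1)).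
have b1 := q_gen n1; have b2 := q_gen n2.
have f1 := qfact_neq0 q_gen n1; have f2 := qfact_neq0 q_gen n2.
by field; rewrite b1 b2 f1 f2.
Qed.

(* Induction on the depth of [a1 + a2] below [mu + 1]: one application of
   Delta F moves the relation down, by [E, F] = [H]. *)
Lemma wt3jE mu1 mu2 mu a1 a2 : generic_weight h mu ->
  br (mu1 - a1 + 1) * qp (2%:R * a2) * G mu1 mu2 mu (a1 - 1) a2
  + br (mu2 - a2 + 1) * G mu1 mu2 mu a1 (a2 - 1)
  = br (mu - (a1 + a2) + 1) * G mu1 mu2 mu a1 a2.
Proof.
move=> g.
pose Eo b1 b2 := br (mu1 - b1 + 1) * qp (2%:R * b2) * G mu1 mu2 mu (b1 - 1) b2
  + br (mu2 - b2 + 1) * G mu1 mu2 mu b1 (b2 - 1).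
have [/isnatP[n]|Nn] := boolP (isnat (mu + 1 - (a1 + a2))); last first.
  have e1 : mu - (a1 - 1 + a2) = mu + 1 - (a1 + a2) by ring.
  have e2 : mu - (a1 + (a2 - 1)) = mu + 1 - (a1 + a2) by ring.
  rewrite !wt3j_eq0t ?e1 ?e2 ?mulr0 ?addr0 //.
  apply: contraNN Nn => /isnatP[k Ek].
  by rewrite addrAC Ek natr1 isnat_nat.
rewrite -/(Eo a1 a2); elim: n a1 a2 => [|n IH] a1 a2 En.
  have ea : a1 + a2 = mu + 1 by apply/esym/eqP; rewrite -subr_eq0 En.
  rewrite /Eo wt3j_singE //; have -> : mu - (a1 + a2) + 1 = 0.
    by rewrite ea; ring.
  by rewrite qnum0 mul0r.
have ea : a1 + a2 = mu - n%:R.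
  by rewrite -[a1 + a2](subKr (mu + 1)) En -natr1; ring.
pose Fo b1 b2 := br (mu1 + b1 + 1) * G mu1 mu2 mu (b1 + 1) b2
  + qp (- (2%:R * b1)) * br (mu2 + b2 + 1) * G mu1 mu2 mu b1 (b2 + 1).
have b0 : br (mu + (a1 + a2)) != 0.
  have -> : mu + (a1 + a2) = 2%:R * mu - n%:R by rewrite ea; ring.
  exact: g.
have nat_neq (b : R[i]) k : b = mu - k.+1%:R -> b != mu.
  move=> ->; rewrite -subr_eq0 addrAC subrr add0r oppr_eq0.
  by rewrite pnatr_eq0.
have F1 : br (mu + (a1 + a2)) * G mu1 mu2 mu (a1 - 1) a2 = Fo (a1 - 1) a2.
  rewrite /Fo -wt3jF //; last first.
    apply: (@nat_neq _ n). by rewrite addrAC ea -natr1; ring.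
  by congr (br _ * _); ring.
have F2 : br (mu + (a1 + a2)) * G mu1 mu2 mu a1 (a2 - 1) = Fo a1 (a2 - 1).
  rewrite /Fo -wt3jF //; last first.
    by apply: (@nat_neq _ n); rewrite addrA ea -natr1; ring.
  by congr (br _ * _); ring.
have E1 : Eo (a1 + 1) a2 = br (mu - (a1 + a2)) * G mu1 mu2 mu (a1 + 1) a2.
  rewrite IH; last by rewrite -[n%:R](subKr mu) -ea; ring.
  by congr (br _ * _); ring.
have E2 : Eo a1 (a2 + 1) = br (mu - (a1 + a2)) * G mu1 mu2 mu a1 (a2 + 1).
  rewrite IH; last by rewrite -[n%:R](subKr mu) -ea; ring.
  by congr (br _ * _); ring.
(* [Eo] and [Fo] are the components of Delta E and Delta F applied to the vector. Here Delta F Delta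
   E is evaluated through the induction hypothesis; at the highest weight, where the recursion for F
   fails, both sides contain [[0]_q]. *)
have FE : br (mu1 + a1 + 1) * Eo (a1 + 1) a2
    + qp (- (2%:R * a1)) * br (mu2 + a2 + 1) * Eo a1 (a2 + 1)
    = br (mu - (a1 + a2)) * br (mu + (a1 + a2) + 1) * G mu1 mu2 mu a1 a2.
  have [em|nm] := eqVneq (a1 + a2) mu.
    by rewrite E1 E2 em subrr qnum0 !mul0r !mulr0 addr0.
  have F0 := wt3jF Delta q_gen mu1 mu2 g nm.
  rewrite E1 E2 -[RHS]mulrA F0; clear; move: (G _ _ _ _ _) (G _ _ _ _ _) => g1 g2.
  ring.
have EF : br (mu + (a1 + a2)) * Eo a1 a2 =
    br (mu1 - a1 + 1) * qp (2%:R * a2) * Fo (a1 - 1) a2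
    + br (mu2 - a2 + 1) * Fo a1 (a2 - 1).
  rewrite -F1 -F2 /Eo; clear; ring.
(* The commutator of Delta E and Delta F acts by [[2(a1 + a2)]_q]: [s1] and [s2] give it on each
   factor, [s] joins the two, and the mixed terms cancel by [q1] and [q2]. *)
have comm : br (mu1 - a1 + 1) * qp (2%:R * a2) * Fo (a1 - 1) a2
    + br (mu2 - a2 + 1) * Fo a1 (a2 - 1)
  = br (mu1 + a1 + 1) * Eo (a1 + 1) a2
    + qp (- (2%:R * a1)) * br (mu2 + a2 + 1) * Eo a1 (a2 + 1)
    + br (2%:R * (a1 + a2)) * G mu1 mu2 mu a1 a2.
  have s1 := @qnum_swap _ _ q_gen (mu1 - a1) (mu1 + a1).
  have s2 := @qnum_swap _ _ q_gen (mu2 - a2) (mu2 + a2).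
  have d1 : mu1 + a1 - (mu1 - a1) = 2%:R * a1 by ring.
  have d2 : mu2 + a2 - (mu2 - a2) = 2%:R * a2 by ring.
  rewrite d1 in s1; rewrite d2 in s2.
  have s : br (2%:R * (a1 + a2)) =
      qp (2%:R * a2) * br (2%:R * a1) + qp (- (2%:R * a1)) * br (2%:R * a2).
    by rewrite mulrDr qnumD.
  rewrite s /Eo /Fo.
  have -> : a1 - 1 + 1 = a1 by ring.
  have -> : a2 - 1 + 1 = a2 by ring.
  have -> : a1 + 1 - 1 = a1 by ring.
  have -> : a2 + 1 - 1 = a2 by ring.
  have -> : mu1 + (a1 - 1) + 1 = mu1 + a1 by ring.
  have -> : mu2 + (a2 - 1) + 1 = mu2 + a2 by ring.
  have -> : mu1 - (a1 + 1) + 1 = mu1 - a1 by ring.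
  have -> : mu2 - (a2 + 1) + 1 = mu2 - a2 by ring.
  have q1 : qp (2%:R * (a2 + 1)) = qp (2%:R * a2) * qp 2%:R.
    by rewrite -qpowD; congr qp; ring.
  have q2 : qp (- (2%:R * (a1 - 1))) = qp (- (2%:R * a1)) * qp 2%:R.
    by rewrite -qpowD; congr qp; ring.
  rewrite q1 q2.
  have -> : br (2%:R * a1) =
     br (mu1 - a1 + 1) * br (mu1 + a1) - br (mu1 - a1) * br (mu1 + a1 + 1).
    by rewrite -s1; ring.
  have -> : br (2%:R * a2) =
     br (mu2 - a2 + 1) * br (mu2 + a2) - br (mu2 - a2) * br (mu2 + a2 + 1).
    by rewrite -s2; ring.
  move: (G mu1 mu2 mu a1 a2) (G mu1 mu2 mu (a1 - 1) (a2 + 1))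
    (G mu1 mu2 mu (a1 + 1) (a2 - 1)) => g0 g1 g2.
  move: (qp (2%:R * a2)) (qp (- (2%:R * a1))) (qp 2%:R) => u1 u2 u3.
  move: (br (mu1 - a1)) (br (mu2 - a2)) (br (mu1 + a1)) (br (mu2 + a2)).
  move: (br (mu1 - a1 + 1)) (br (mu2 - a2 + 1)) (br (mu1 + a1 + 1))
    (br (mu2 + a2 + 1)) => v1 v2 v3 v4 w1 w2 w3 w4.
  ring.
apply: (mulfI b0); rewrite EF comm FE -mulrDl.
have := @qnum_swap _ _ q_gen (mu - (a1 + a2)) (mu + (a1 + a2)).
have -> : mu + (a1 + a2) - (mu - (a1 + a2)) = 2%:R * (a1 + a2) by ring.
by move=> ->; rewrite -mulrA mulrCA.
Qed.

Hypothesis Delta_sym : forall mu1 mu2 mu, Delta mu1 mu2 mu = Delta mu2 mu1 mu.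

(* When one of the two weights is the highest one, the sum in the 3j-symbol
   has a single term; this is the only trace of the R-matrix in the proof. *)
Lemma wt3j_flip mu1 nu mu a :
  G nu mu1 mu a mu1 =
  m1pow (mu1 + nu - mu)
  * qp (mu * (mu + 1) - mu1 * (mu1 + 1) - nu * (nu + 1) - 2%:R * mu1 * a)
  * G mu1 nu mu mu1 a.
Proof.
have [/isnatP[J EJ]|nJ] := boolP (isnat (mu1 + nu - mu)); last first.
  by rewrite !wt3j_eq0J ?mulr0 // (addrC nu).
have [/isnatP[p Ep]|np] := boolP (isnat (nu - a)); last first.
  by rewrite wt3j_eq0l // wt3j_eq0r ?mulr0.
have [/isnatP[n En]|nn] := boolP (isnat (mu - (a + mu1))); last first.
  by rewrite !wt3j_eq0t ?mulr0 // (addrC mu1).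
have Emu : mu = mu1 + nu - J%:R by rewrite -EJ; ring.
have Emu' : mu = nu + mu1 - J%:R by rewrite Emu; ring.
have Ea : a = nu - p%:R by rewrite -Ep; ring.
have nn : (p = n + J)%N.
  by apply: (@natrI R); rewrite natrD -Ep -EJ -En; ring.
have pn : (p - n = J)%N by rewrite nn addKn.
have le_np : (n <= p)%N by rewrite nn leq_addr.
have := wt3j_nat h Delta (n := n) (n1 := 0) (n2 := p) Emu nn.
have := wt3j_nat h Delta (n := n) (n1 := p) (n2 := 0) Emu' (etrans (addn0 _) nn).
rewrite subr0 -Ea => -> ->; rewrite EJ m1pow_nat (Delta_sym nu).
have -> : sum3j h nu mu1 mu n p 0 = (-1) ^+ n
    * qp (n%:R * (2%:R * mu - n%:R + 1)) * qrise (2%:R * nu - p%:R) n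
    / (qfact h n * qfact h J).
  rewrite /sum3j big_ord_recr /= big1 ?add0r.
    rewrite subnn qrise0 qfact0 !mulr1 /qrfact leq0n subnn qfact0 invr1 mulr1.
    rewrite le_np pn invfM; ring.
  move=> z _; have lz := ltn_ord z; rewrite /qrfact /=.
  have -> : (n - z <= 0)%N = false by rewrite leqn0 subn_eq0 leqNgt lz.
  by rewrite !mulr0.
have -> : sum3j h mu1 nu mu n 0 p =
    qrise (2%:R * nu - p%:R) n / (qfact h n * qfact h J).
  rewrite /sum3j big_ord_recl /= big1 ?addr0.
    rewrite expr0 mul0r qpow0 !mul1r qrise0 qfact0 subn0 !mul1r /qrfact leq0n.
    by rewrite subnn qfact0 invr1 mul1r le_np pn invfM; ring.
  by move=> z _; rewrite /qrfact /= !mul0r !mulr0.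
have sg : (-1) ^+ p * (-1) ^+ n = (-1) ^+ J :> R[i].
  by rewrite nn exprD mulrAC -exprD addnn -mul2n exprM sqrrN !expr1n mul1r.
rewrite expr0 mul1r -{1}sg.
set A := qp _; set B := qp (n%:R * _); set A' := qp _; set B' := qp _.
have e : A * B = A' * B'.
  rewrite -!qpowD; congr qp; rewrite Ea Emu nn natrD !expr2; ring.
transitivity ((A * B) * ((-1) ^+ p * (-1) ^+ n * m1pow (J%:R / 2%:R)
  * (qfact h n * Delta mu1 nu mu / qrise (2%:R * mu - n%:R) n)
  * (qrise (2%:R * nu - p%:R) n / (qfact h n * qfact h J)))); first by ring.
rewrite e; ring.
Qed.

End ThreeJ2.

(** * Orthogonality of the 3j-symbols *)

Section Vandermonde.
Variables (R : realType) (h : R[i]).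
Hypothesis q_gen : forall n : nat, qnum h n.+1%:R != 0.
Local Notation qp := (qpow h).
Local Notation br := (qnum h).
Implicit Types (x y mu a : R[i]) (n : nat).

Definition qfall x n : R[i] := \prod_(k < n) br (x - k%:R).

Lemma qfall0 x : qfall x 0 = 1. Proof. exact: big_ord0. Qed.

Lemma qfallSr x n : qfall x n.+1 = qfall x n * br (x - n%:R).
Proof. exact: big_ord_recr. Qed.

Lemma qfallSl x n : qfall x n.+1 = br x * qfall (x - 1) n.
Proof.
rewrite /qfall big_ord_recl subr0; congr (_ * _); apply: eq_bigr => k _.
by rewrite /bump /= natrD opprD addrA.
Qed.

Lemma qfall_neq0 x n : (forall k : nat, br (x - k%:R) != 0) -> qfall x n != 0.
Proof. by move=> gx; apply/prodf_neq0 => k _. Qed.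

(** For x = 2 mu1 and y = 2 mu2: twice the exponent of q in the singular 3j-symbol at depths i, j,
    plus the depth-dependent exponents of the two norms [vnorm]. *)
Definition vand_exp x y (i j : nat) : R[i] :=
  y * j%:R - j%:R ^+ 2 - j%:R - 3%:R * i%:R - x * i%:R + i%:R ^+ 2.

(** Splitting [[J + 1]] as [q^(J + 1 - i) [i] + q^(-i) [J + 1 - i]] in the general term lowers J
    together with x or with y. The right side satisfies the same recursion, by the splitting of
    [[(x - J) + (y - J)]]. *)
Lemma q_vandermonde (J : nat) x y :
  (forall k : nat, br (x - k%:R) != 0) -> (forall k : nat, br (y - k%:R) != 0) ->
  \sum_(i < J.+1) qp (vand_exp x y i (J - i))
    / (qfact h i * qfact h (J - i) * qfall x i * qfall y (J - i))
  = qp (- (2%:R * J%:R)) * \prod_(k < J) br (x + y - 2%:R * J%:R + 2%:R + k%:R)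
    / (qfact h J * qfall x J * qfall y J).
Proof.
elim: J x y => [|J IH] x y gx gy.
  rewrite big_ord1 big_ord0 subnn /= qfact0 !qfall0 !mulr1 invr1.
  by congr (qp _ * _); rewrite /vand_exp !expr2; ring.
have gx1 (k : nat) : br (x - 1 - k%:R) != 0.
  by have := gx k.+1; rewrite -nat1r opprD addrA.
have gy1 (k : nat) : br (y - 1 - k%:R) != 0.
  by have := gy k.+1; rewrite -nat1r opprD addrA.
have x0 : br x != 0 by have := gx 0; rewrite subr0.
have y0 : br y != 0 by have := gy 0; rewrite subr0.
pose f i := qp (vand_exp x y i (J.+1 - i))
    / (qfact h i * qfact h (J.+1 - i) * qfall x i * qfall y (J.+1 - i)).
have recV : br J.+1%:R * (\sum_(i < J.+2) f i) =
  qp (J%:R - 2%:R - x) / br x * (\sum_(i < J.+1) qp (vand_exp (x - 1) y i (J - i))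
    / (qfact h i * qfact h (J - i) * qfall (x - 1) i * qfall y (J - i)))
  + qp (y - 2%:R - J%:R) / br y *
    (\sum_(i < J.+1) qp (vand_exp x (y - 1) i (J - i))
    / (qfact h i * qfact h (J - i) * qfall x i * qfall (y - 1) (J - i))).
  rewrite mulr_sumr (eq_bigr (fun i : 'I_J.+2 =>
     qp (J.+1 - i)%:R * br i%:R * f i + qp (- i%:R) * br (J.+1 - i)%:R * f i));
    last first.
    move=> i _; have {1}-> : J.+1%:R = i%:R + (J.+1 - i)%:R :> R[i].
      by rewrite -natrD subnKC // -ltnS.
    by rewrite qnumD // mulrDl.
  rewrite big_split /= big_ord_recl /= qnum0 mulr0 mul0r add0r; congr (_ + _).
    rewrite mulr_sumr; apply: eq_bigr => i _.
    have lei : (i <= J)%N by rewrite -ltnS.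
    rewrite /bump /= add1n subSS /f subSS qfactS qfallSl.
    have fi := qfact_neq0 q_gen i; have fj := qfact_neq0 q_gen (J - i).
    have b0 := q_gen i.
    have r1 := qfall_neq0 i gx1; have r2 := qfall_neq0 (J - i) gy.
    have e : qp (J - i)%:R * qp (vand_exp x y i.+1 (J - i)) =
      qp (J%:R - 2%:R - x) * qp (vand_exp (x - 1) y i (J - i)).
      rewrite -!qpowD; congr qp.
      rewrite /vand_exp (natrB _ lei) -[i.+1%:R]natr1.
      by rewrite !expr2; ring.
    transitivity (qp (J - i)%:R * qp (vand_exp x y i.+1 (J - i))
      / (qfact h i * qfact h (J - i) * (br x * qfall (x - 1) i)
         * qfall y (J - i))).
      by field; rewrite fi fj b0 r1 r2 x0.
    by rewrite e; field; rewrite fi fj r1 r2 x0.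
  rewrite big_ord_recr /= subnn qnum0 mulr0 mul0r addr0 mulr_sumr.
  apply: eq_bigr => i _.
  have lei : (i <= J)%N by rewrite -ltnS.
  rewrite /f subSn // qfactS qfallSl.
  have fi := qfact_neq0 q_gen i; have fj := qfact_neq0 q_gen (J - i).
  have b0 := q_gen (J - i).
  have r1 := qfall_neq0 i gx; have r2 := qfall_neq0 (J - i) gy1.
  have e : qp (- i%:R) * qp (vand_exp x y i (J - i).+1) =
    qp (y - 2%:R - J%:R) * qp (vand_exp x (y - 1) i (J - i)).
    rewrite -!qpowD; congr qp; rewrite /vand_exp -natr1 (natrB _ lei) !expr2.
    by ring.
  transitivity (qp (- i%:R) * qp (vand_exp x y i (J - i).+1)
      / (qfact h i * qfact h (J - i) * qfall x i
         * (br y * qfall (y - 1) (J - i)))).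
    by field; rewrite fi fj b0 r1 r2 y0.
  by rewrite e; field; rewrite fi fj r1 r2 y0.
apply: (mulfI (q_gen J)); rewrite [LHS]recV (IH _ _ gx1 gy) (IH _ _ gx gy1).
have -> : \prod_(k < J) br (x - 1 + y - 2%:R * J%:R + 2%:R + k%:R) =
    \prod_(k < J) br (x + y - 2%:R * J%:R + 1 + k%:R).
  by apply: eq_bigr => k _; congr br; ring.
have -> : \prod_(k < J) br (x + (y - 1) - 2%:R * J%:R + 2%:R + k%:R) =
    \prod_(k < J) br (x + y - 2%:R * J%:R + 1 + k%:R).
  by apply: eq_bigr => k _; congr br; ring.
have -> : \prod_(k < J.+1) br (x + y - 2%:R * J.+1%:R + 2%:R + k%:R) =
    br ((x - J%:R) + (y - J%:R)) *
    \prod_(k < J) br (x + y - 2%:R * J%:R + 1 + k%:R).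
  rewrite big_ord_recl; congr (br _ * _).
    by rewrite /= -[J.+1%:R]natr1; ring.
  apply: eq_bigr => k _; congr br; rewrite lift0.
  by rewrite -[J.+1%:R]natr1 -[k.+1%:R]natr1; ring.
rewrite qnumD //.
have -> : qfall x J.+1 = br x * qfall (x - 1) J by exact: qfallSl.
have -> : qfall y J.+1 = br y * qfall (y - 1) J by exact: qfallSl.
have rx : br x * qfall (x - 1) J = qfall x J * br (x - J%:R).
  by rewrite -qfallSl qfallSr.
have ry : br y * qfall (y - 1) J = qfall y J * br (y - J%:R).
  by rewrite -qfallSl qfallSr.
have xJ := gx J; have yJ := gy J.
have r1 := qfall_neq0 J gx; have r2 := qfall_neq0 J gy.
have r3 := qfall_neq0 J gx1; have r4 := qfall_neq0 J gy1.
have -> : qfall x J = br x * qfall (x - 1) J / br (x - J%:R).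
  by rewrite rx mulfK.
have -> : qfall y J = br y * qfall (y - 1) J / br (y - J%:R).
  by rewrite ry mulfK.
rewrite qfactS.
have e1 : qp (J%:R - 2%:R - x) * qp (- (2%:R * J%:R)) =
    qp (- (2%:R * J.+1%:R)) * qp (- (x - J%:R)).
  by rewrite -!qpowD -natr1; congr qp; ring.
have e2 : qp (y - 2%:R - J%:R) * qp (- (2%:R * J%:R)) =
    qp (- (2%:R * J.+1%:R)) * qp (y - J%:R).
  by rewrite -!qpowD -natr1; congr qp; ring.
have fJ := qfact_neq0 q_gen J; have b0 := q_gen J.
move: (\prod_(k < J) _) => P.
transitivity (
  (qp (J%:R - 2%:R - x) * qp (- (2%:R * J%:R)) * br (y - J%:R)
   + qp (y - 2%:R - J%:R) * qp (- (2%:R * J%:R)) * br (x - J%:R)) * P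
  / (qfact h J * (br x * qfall (x - 1) J) * (br y * qfall (y - 1) J))).
  by field; rewrite fJ r3 r4 x0 y0 xJ yJ.
by rewrite e1 e2; field; rewrite fJ r3 r4 x0 y0 b0.
Qed.

End Vandermonde.

(** * The contravariant form on tensor products of two Verma modules *)

Section Orthogonality.
Variables (R : realType) (h : R[i]) (Delta : R[i] -> R[i] -> R[i] -> R[i]).
Hypothesis q_gen : forall n : nat, qnum h n.+1%:R != 0.
Hypothesis DeltaP : Delta_choice h Delta.
Local Notation qp := (qpow h).
Local Notation br := (qnum h).
Local Notation G := (wt3j h Delta).
Local Notation qfall := (qfall h).
Implicit Types (x y mu a : R[i]) (n : nat).

Lemma generic_weightB mu n :
  generic_weight h mu -> generic_weight h (mu - n%:R).
Proof.
move=> g k; have -> : 2%:R * (mu - n%:R) - k%:R = 2%:R * mu - (2 * n + k)%:R.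
  by rewrite natrD natrM; ring.
exact: g.
Qed.

(* Norm of [e^mu_(mu - n)] for the form that makes [E] adjoint to [F K]. *)
Definition vnorm mu n : R[i] :=
  m1pow mu * qp (2%:R * mu) * qfact h n
  * qp (- (2%:R * mu * n%:R - n%:R ^+ 2 + n%:R)) / qfall (2%:R * mu) n.

Lemma vnormS mu n : generic_weight h mu ->
  vnorm mu n.+1 * br (2%:R * mu - n%:R) =
  br n.+1%:R * qp (- (2%:R * (mu - n%:R))) * vnorm mu n.
Proof.
move=> g; rewrite /vnorm qfactS qfallSr.
have -> : - (2%:R * mu * n.+1%:R - n.+1%:R ^+ 2 + n.+1%:R) =
    - (2%:R * (mu - n%:R)) + - (2%:R * mu * n%:R - n%:R ^+ 2 + n%:R).
  by rewrite -[n.+1%:R]natr1 !expr2; ring.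
rewrite (qpowD h (- (2%:R * (mu - n%:R)))).
by have f0 := qfall_neq0 n g; have b0 := g n; field; rewrite f0 b0.
Qed.

Lemma vnorm_neq0 mu n : generic_weight h mu -> vnorm mu n != 0.
Proof.
move=> g; apply: mulf_neq0; last by rewrite invr_eq0; exact: qfall_neq0.
apply: mulf_neq0 (qpow_neq0 _ _); apply: mulf_neq0 (qfact_neq0 q_gen _).
exact: mulf_neq0 (m1pow_neq0 _) (qpow_neq0 _ _).
Qed.

(** The product form on the weight space at depth p. It is bilinear, without conjugation, which is
    why the 6j-matrix will be inverted by a plain transpose. *)
Definition dot2 mu1 mu2 (p : nat) (f g : nat -> nat -> R[i]) : R[i] :=
  \sum_(i < p.+1) vnorm mu1 i * vnorm mu2 (p - i) * f i (p - i)%N * g i (p - i)%N.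

Lemma dot2C mu1 mu2 p f g : dot2 mu1 mu2 p f g = dot2 mu1 mu2 p g f.
Proof. by apply: eq_bigr => i _; rewrite mulrAC. Qed.

(** Adjointness on the factors passes to Delta E and Delta F because the twists by K in the
    coproduct match the weights in [vnormS]. The scalar in front is the inverse of K at depth p. *)
Lemma dot2_adj mu1 mu2 p (f g : nat -> nat -> R[i]) :
  generic_weight h mu1 -> generic_weight h mu2 ->
  dot2 mu1 mu2 p.+1
    (fun i j => (if i is m.+1 then br (2%:R * mu1 - m%:R) * f m j else 0)
       + qp (- (2%:R * (mu1 - i%:R)))
         * (if j is m.+1 then br (2%:R * mu2 - m%:R) * f i m else 0)) g
  = qp (- (2%:R * (mu1 + mu2 - p%:R)))
    * dot2 mu1 mu2 p f
    (fun i j => br i.+1%:R * qp (2%:R * (mu2 - j%:R)) * g i.+1 j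
                + br j.+1%:R * g i j.+1).
Proof.
move=> g1 g2; rewrite /dot2.
under eq_bigr do rewrite mulrDr mulrDl.
rewrite big_split /= big_ord_recl /= mulr0 mul0r add0r.
rewrite [X in _ + X]big_ord_recr /= subnn !mulr0 mul0r addr0.
rewrite -big_split mulr_sumr; apply: eq_bigr => i _ /=.
have lei : (i <= p)%N by rewrite -ltnS.
rewrite /bump /= add1n subSS subSn //.
have v1 := vnormS i g1; have v2 := vnormS (p - i) g2.
set f0 := f i (p - i)%N; set ga := g i.+1 _; set gb := g i _.
transitivity ((vnorm mu1 i.+1 * br (2%:R * mu1 - i%:R)) * vnorm mu2 (p - i) * f0 * ga
  + vnorm mu1 i * (vnorm mu2 (p - i).+1 * br (2%:R * mu2 - (p - i)%:R))
    * qp (- (2%:R * (mu1 - i%:R))) * f0 * gb); first by ring.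
rewrite v1 v2.
have e1 : qp (- (2%:R * (mu1 - i%:R))) =
    qp (- (2%:R * (mu1 + mu2 - p%:R))) * qp (2%:R * (mu2 - (p - i)%:R)).
  by rewrite -qpowD (natrB _ lei); congr qp; ring.
have e2 : qp (- (2%:R * (mu2 - (p - i)%:R))) * qp (- (2%:R * (mu1 - i%:R))) =
    qp (- (2%:R * (mu1 + mu2 - p%:R))).
  by rewrite -qpowD (natrB _ lei); congr qp; ring.
transitivity (qp (- (2%:R * (mu1 - i%:R))) * (br i.+1%:R * vnorm mu1 i
     * vnorm mu2 (p - i) * f0 * ga)
  + (qp (- (2%:R * (mu2 - (p - i)%:R))) * qp (- (2%:R * (mu1 - i%:R))))
   * (br (p - i).+1%:R * vnorm mu1 i * vnorm mu2 (p - i) * f0 * gb)).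
  by ring.
by rewrite e2 {1}e1; ring.
Qed.

Definition nat3j mu1 mu2 J (i j : nat) : R[i] :=
  G mu1 mu2 (mu1 + mu2 - J%:R) (mu1 - i%:R) (mu2 - j%:R).

Lemma nat3j_eq0 mu1 mu2 J i j : (i + j < J)%N -> nat3j mu1 mu2 J i j = 0.
Proof.
move=> lt; rewrite /nat3j wt3j_eq0t //.
have -> : mu1 + mu2 - J%:R - (mu1 - i%:R + (mu2 - j%:R)) =
    (i + j)%:R - J%:R by rewrite natrD; ring.
by apply/negP => /isnat_subn; rewrite leqNgt lt.
Qed.

Lemma nat3jE mu1 mu2 J i j : generic_weight h (mu1 + mu2) ->
  br i.+1%:R * qp (2%:R * (mu2 - j%:R)) * nat3j mu1 mu2 J i.+1 j
  + br j.+1%:R * nat3j mu1 mu2 J i j.+1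
  = br ((i + j).+1%:R - J%:R) * nat3j mu1 mu2 J i j.
Proof.
move=> g; rewrite /nat3j.
have := wt3jE Delta q_gen mu1 mu2 (mu1 - i%:R) (mu2 - j%:R) (generic_weightB J g).
have -> : mu1 - (mu1 - i%:R) + 1 = i.+1%:R by rewrite -natr1; ring.
have -> : mu2 - (mu2 - j%:R) + 1 = j.+1%:R by rewrite -natr1; ring.
have -> : mu1 - i%:R - 1 = mu1 - i.+1%:R by rewrite -natr1; ring.
have -> : mu2 - j%:R - 1 = mu2 - j.+1%:R by rewrite -natr1; ring.
move=> ->; congr (br _ * _); rewrite -[(i + j).+1%:R]natr1 natrD; ring.
Qed.

Lemma Delta_sqr mu1 mu2 J : Delta mu1 mu2 (mu1 + mu2 - J%:R) ^+ 2 =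
  qfact h J * (qfall (2%:R * mu1) J * qfall (2%:R * mu2) J
    / \prod_(k < J) br (2%:R * (mu1 + mu2 - J%:R) + 2%:R + k%:R)).
Proof.
case: DeltaP => D2 _; rewrite D2 /Delta_radicand /qfall -big_split.
by rewrite -prodf_div.
Qed.

(** For k < J the argument equals 2 (mu1 + mu2) minus the natural number 2J - k - 2, so genericity
    of the sum applies. *)
Lemma Delta_den_neq0 mu1 mu2 J : generic_weight h (mu1 + mu2) ->
  \prod_(k < J) br (2%:R * (mu1 + mu2 - J%:R) + 2%:R + k%:R) != 0.
Proof.
move=> g; apply/prodf_neq0 => k _.
have lek : (k + 2 <= 2 * J)%N.
  rewrite mul2n -addnn (addnS k 1) -addSn.
  by apply: leq_add; [|apply: leq_ltn_trans (ltn_ord k)].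
have -> : 2%:R * (mu1 + mu2 - J%:R) + 2%:R + k%:R =
    2%:R * (mu1 + mu2) - (2 * J - (k + 2))%:R.
  by rewrite (natrB _ lek) natrM natrD; ring.
exact: g.
Qed.

Lemma Delta_neq0 mu1 mu2 J : generic_weight h mu1 -> generic_weight h mu2 ->
  generic_weight h (mu1 + mu2) -> Delta mu1 mu2 (mu1 + mu2 - J%:R) != 0.
Proof.
move=> g1 g2 g; rewrite -sqrf_eq0 Delta_sqr.
apply: mulf_neq0 (qfact_neq0 q_gen _) _; apply: mulf_neq0.
  exact: mulf_neq0 (qfall_neq0 _ g1) (qfall_neq0 _ g2).
by rewrite invr_eq0 Delta_den_neq0.
Qed.

(** These symbols become denominators when a tree is expanded from its components with the first
    factor highest. *)
Lemma nat3j_top mu1 mu2 J : generic_weight h mu1 -> generic_weight h mu2 ->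
  generic_weight h (mu1 + mu2) -> nat3j mu1 mu2 J 0 J != 0.
Proof.
move=> g1 g2 g; rewrite /nat3j (wt3j_sing Delta q_gen (J := J)) //.
apply: mulf_neq0; last first.
  by rewrite invr_eq0; exact: mulf_neq0 (qfact_neq0 q_gen _) (qfact_neq0 q_gen _).
apply: mulf_neq0 (Delta_neq0 _ g1 g2 g); apply: mulf_neq0 (qpow_neq0 _ _).
exact: mulf_neq0 (oner_neq0 _) (m1pow_neq0 _).
Qed.

(** Squared singular symbols weighted by the norms give the sum of [q_vandermonde], and the radicand
    of Delta cancels its value. The remaining [(-1)^J q^(-2J)] is absorbed by the factor
    [m1pow mu * q^(2 mu)] of [vnorm], so that the norm depends on the resulting weight alone. *)
Lemma norm_sing mu1 mu2 J : generic_weight h mu1 -> generic_weight h mu2 ->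
  generic_weight h (mu1 + mu2) ->
  dot2 mu1 mu2 J (nat3j mu1 mu2 J) (nat3j mu1 mu2 J) =
  vnorm (mu1 + mu2 - J%:R) 0.
Proof.
move=> g1 g2 g; set mu := mu1 + mu2 - J%:R.
have term (i : 'I_J.+1) : vnorm mu1 i * vnorm mu2 (J - i)
    * nat3j mu1 mu2 J i (J - i) * nat3j mu1 mu2 J i (J - i) =
    m1pow (mu1 + mu2) * qp (2%:R * (mu1 + mu2)) * m1pow J%:R
    * Delta mu1 mu2 mu ^+ 2 *
    (qp (vand_exp (2%:R * mu1) (2%:R * mu2) i (J - i))
    / (qfact h i * qfact h (J - i) * qfall (2%:R * mu1) i
       * qfall (2%:R * mu2) (J - i))).
  have lei : (i <= J)%N by rewrite -ltnS.
  rewrite /nat3j (wt3j_sing Delta q_gen (J := J)) ?subnKC // -/mu /vnorm.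
  set j := (J - i)%N; set E := 2%:R * mu2 * j%:R - j%:R ^+ 2 - i%:R.
  set E1 := - (2%:R * mu1 * i%:R - i%:R ^+ 2 + i%:R).
  set E2 := - (2%:R * mu2 * j%:R - j%:R ^+ 2 + j%:R).
  have -> : qp (vand_exp (2%:R * mu1) (2%:R * mu2) i j) =
      qp E * qp E * qp E1 * qp E2.
    by rewrite -!qpowD; congr qp; rewrite /vand_exp /E /E1 /E2 !expr2; ring.
  have -> : m1pow J%:R = m1pow (J%:R / 2%:R) * m1pow (J%:R / 2%:R) :> R[i].
    by rewrite -m1powD; congr m1pow; field.
  have -> : qp (2%:R * (mu1 + mu2)) = qp (2%:R * mu1) * qp (2%:R * mu2).
    by rewrite -qpowD; congr qp; ring.
  rewrite m1powD.
  have sg : (-1) ^+ i * (-1) ^+ i = 1 :> R[i].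
    by rewrite -exprD addnn -mul2n exprM sqrrN !expr1n.
  have fi := qfact_neq0 q_gen i; have fj := qfact_neq0 q_gen j.
  have r1 := qfall_neq0 i g1; have r2 := qfall_neq0 j g2.
  transitivity (((-1) ^+ i * (-1) ^+ i) * (m1pow mu1 * m1pow mu2 *
   (qp (2%:R * mu1) * qp (2%:R * mu2)) *
   (m1pow (J%:R / 2%:R) * m1pow (J%:R / 2%:R)) * Delta mu1 mu2 mu ^+ 2 *
   (qp E * qp E * qp E1 * qp E2 /
    (qfact h i * qfact h j * qfall (2%:R * mu1) i * qfall (2%:R * mu2) j)))).
    by field; rewrite fi fj r1 r2.
  by rewrite sg mul1r.
rewrite /dot2 (eq_bigr _ (fun i _ => term i)) -mulr_sumr q_vandermonde //.
rewrite Delta_sqr /vnorm qfact0 qfall0 invr1 !mulr1.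
have -> : \prod_(k < J)
    br (2%:R * mu1 + 2%:R * mu2 - 2%:R * J%:R + 2%:R + k%:R) =
  \prod_(k < J) br (2%:R * (mu1 + mu2 - J%:R) + 2%:R + k%:R).
  by apply: eq_bigr => k _; congr br; ring.
have p0 := Delta_den_neq0 J g; have fJ := qfact_neq0 q_gen J.
have r1 := qfall_neq0 J g1; have r2 := qfall_neq0 J g2.
move: (\prod_(k < J) _) p0 => P p0.
have -> : - (2%:R * mu * 0%:R - 0%:R ^+ 2 + 0%:R) = 0 :> R[i].
  by rewrite !expr2; ring.
rewrite qpow0 mulr1.
have -> : m1pow mu = m1pow (mu1 + mu2) * m1pow J%:R.
  (* The sign [m1pow] does not distinguish -J from J, as they differ by the even number 2J. *)
  have -> : mu = (mu1 + mu2 - (2 * J)%:R) + J%:R.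
    by rewrite /mu natrM; ring.
  have e : m1pow (- (2 * J)%:R) = 1 :> R[i].
    by rewrite m1powN m1pow_nat exprM sqrrN !expr1n invr1.
  by rewrite m1powD (m1powD (mu1 + mu2)) e mulr1.
have -> : qp (2%:R * mu) = qp (2%:R * (mu1 + mu2)) * qp (- (2%:R * J%:R)).
  by rewrite -qpowD; congr qp; rewrite /mu; ring.
by field; rewrite p0 fJ r1 r2.
Qed.

(** Below its singular vector each summand is reached by F, so adjointness carries a pairing at
    depth p to depth p + 1. Only the summand J = p + 1 is new there: its norm is [norm_sing], and
    symmetry of the form reduces its pairing with the older summands to the case already treated. *)
Lemma orth2 mu1 mu2 : generic_weight h mu1 -> generic_weight h mu2 ->
  generic_weight h (mu1 + mu2) -> forall p J J' : nat,
  dot2 mu1 mu2 p (nat3j mu1 mu2 J) (nat3j mu1 mu2 J') =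
  if (J == J') && (J <= p)%N then vnorm (mu1 + mu2 - J%:R) (p - J) else 0.
Proof.
move=> g1 g2 g; have dot0 p J J' : (p < J)%N ->
    dot2 mu1 mu2 p (nat3j mu1 mu2 J) (nat3j mu1 mu2 J') = 0.
  move=> lt; rewrite /dot2 big1 // => i _; rewrite nat3j_eq0 ?mulr0 ?mul0r //.
  by rewrite subnKC // -ltnS.
have step p J J' : (J <= p)%N ->
    br (2%:R * (mu1 + mu2 - J%:R) - (p - J)%:R) *
    dot2 mu1 mu2 p.+1 (nat3j mu1 mu2 J) (nat3j mu1 mu2 J') =
    qp (- (2%:R * (mu1 + mu2 - p%:R))) * br (p.+1%:R - J'%:R) *
    dot2 mu1 mu2 p (nat3j mu1 mu2 J) (nat3j mu1 mu2 J').
  move=> le; have gJ := generic_weightB J g.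
  transitivity (dot2 mu1 mu2 p.+1 (fun i j =>
       (if i is m.+1 then br (2%:R * mu1 - m%:R) * nat3j mu1 mu2 J m j else 0)
       + qp (- (2%:R * (mu1 - i%:R)))
         * (if j is m.+1 then br (2%:R * mu2 - m%:R) * nat3j mu1 mu2 J i m
            else 0)) (nat3j mu1 mu2 J')).
    rewrite /dot2 mulr_sumr; apply: eq_bigr => i _.
    have nn : (i + (p.+1 - i) = (p - J).+1 + J)%N.
      by rewrite subnKC -1?ltnS // addSn subnK.
    have F0 := wt3j_natF Delta q_gen gJ (erefl _) nn.
    by rewrite /nat3j -F0; ring.
  rewrite dot2_adj // -mulrA; congr (_ * _); rewrite /dot2 mulr_sumr.
  apply: eq_bigr => i _; rewrite nat3jE // subnKC -1?ltnS //; ring.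
elim=> [|p IH] J J'.
  case: J => [|J]; last by rewrite dot0 // andbF.
  case: J' => [|J']; last by rewrite dot2C dot0.
  by rewrite norm_sing.
have key J1 J2 : (J1 <= p)%N ->
    dot2 mu1 mu2 p.+1 (nat3j mu1 mu2 J1) (nat3j mu1 mu2 J2) =
    if J1 == J2 then vnorm (mu1 + mu2 - J1%:R) (p.+1 - J1) else 0.
  move=> le; have gJ := generic_weightB J1 g.
  apply: (mulfI (gJ (p - J1)%N)); rewrite step // IH le andbT.
  have [<-|ne] := eqVneq J1 J2; last by rewrite !mulr0.
  rewrite subSn // [RHS]mulrC vnormS //.
  have -> : mu1 + mu2 - J1%:R - (p - J1)%:R = mu1 + mu2 - p%:R.
    by rewrite natrB //; ring.
  have -> : p.+1%:R - J1%:R = (p - J1).+1%:R :> R[i].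
    by rewrite -subSn // natrB // ltnW.
  by rewrite -mulrA mulrCA mulrA.
have [lt|ge] := ltnP p.+1 J; first by rewrite dot0 // andbF.
move: ge; rewrite leq_eqVlt => /orP[/eqP ->|].
  have [lt|ge] := ltnP p.+1 J'.
    by rewrite dot2C dot0 // ifF // (ltn_eqF lt).
  move: ge; rewrite leq_eqVlt => /orP[/eqP ->|lt].
    by rewrite eqxx subnn norm_sing.
  rewrite dot2C key ?ifF //; first by rewrite gtn_eqF.
  by rewrite ltn_eqF.
by rewrite ltnS => le; rewrite key // andbT.
Qed.

(** At depth p there are p + 1 basis tensors and p + 1 summands reaching that depth, so the matrix
    of 3j-symbols is square and the one-sided inverse given by orthogonality is two-sided. *)
Lemma complete2 mu1 mu2 (p : nat) (g : nat -> R[i]) :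
  generic_weight h mu1 -> generic_weight h mu2 ->
  generic_weight h (mu1 + mu2) ->
  exists x : nat -> R[i], forall i, (i <= p)%N ->
    g i = \sum_(k < p.+1) x k * nat3j mu1 mu2 k i (p - i).
Proof.
move=> g1 g2 gg.
pose A := \matrix_(k < p.+1, i < p.+1) nat3j mu1 mu2 k i (p - i).
pose B := \matrix_(i < p.+1, k < p.+1) (vnorm mu1 i * vnorm mu2 (p - i)
  * nat3j mu1 mu2 k i (p - i) / vnorm (mu1 + mu2 - k%:R) (p - k)).
have AB : A *m B = 1%:M.
  apply/matrixP => k l; rewrite !mxE.
  have le : (l <= p)%N by rewrite -ltnS.
  transitivity (dot2 mu1 mu2 p (nat3j mu1 mu2 l) (nat3j mu1 mu2 k)
     / vnorm (mu1 + mu2 - l%:R) (p - l)).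
    rewrite /dot2 mulr_suml; apply: eq_bigr => i _; rewrite !mxE.
    by move: (vnorm _ _)^-1 => v; ring.
  rewrite orth2 // le andbT eq_sym -val_eqE /=.
  case: eqP => _; last by rewrite mul0r.
  rewrite divff //; exact: vnorm_neq0 (generic_weightB _ gg).
exists (fun k => \sum_(i < p.+1) g i * B i (inord k)) => i le.
have BA := mulmx1C AB.
transitivity (\sum_(k < p.+1) \sum_(l < p.+1) g l * B l k * A k (inord i)). Show.
  have BAl (l : 'I_p.+1) : \sum_(k < p.+1) g l * B l k * A k (inord i) =
      g l * (l == inord i)%:R.
    have /matrixP/(_ l (inord i)) := BA; rewrite !mxE => <-.
    by rewrite mulr_sumr; apply: eq_bigr => k _; rewrite mulrA.
  rewrite exchange_big /= (eq_bigr _ (fun l _ => BAl l)) (bigD1 (inord i)) //=.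
  rewrite eqxx mulr1 inordK // big1 ?addr0 // => l ne.
  by rewrite (negbTE ne) mulr0.
apply: eq_bigr => k _; rewrite -mulr_suml inord_val; congr (_ * _).
by rewrite mxE inordK.
Qed.

End Orthogonality.

(** * Trees in triple tensor products *)

Section TriangularSums.
Variables (V : nmodType) (N : nat).
Implicit Types F : nat -> nat -> nat -> V.

Lemma sum_diag (i : nat) (F : nat -> nat -> V) : (i <= N)%N ->
  \sum_(j < N.+1) \sum_(k < N.+1 | (i + j + k == N)%N) F j k =
  \sum_(j < (N - i).+1) F j (N - i - j)%N.
Proof.
move=> le; have leN : ((N - i).+1 <= N.+1)%N by rewrite ltnS leq_subr.
rewrite (big_ord_widen_cond _ predT (fun j => F j (N - i - j)%N) leN) /=.
rewrite [RHS]big_mkcond /=; apply: eq_bigr => j _; rewrite ltnS.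
have [lej|ltj] := leqP j (N - i); last first.
  by rewrite big_pred0 // => k; lia.
have lt : (N - i - j < N.+1)%N by lia.
rewrite (big_pred1 (Ordinal lt)) // => k; rewrite /= -val_eqE /=.
by lia.
Qed.

(** The order of summation suits right-nested trees: with the depth of factor 1 outside, the inner
    sum is a pairing on factors 2 and 3. For left-nested trees [sum_tri_r] puts factor 3 outside. *)
Lemma sum_tri_l F :
  \sum_(i < N.+1) \sum_(j < N.+1) \sum_(k < N.+1 | (i + j + k == N)%N) F i j k =
  \sum_(i < N.+1) \sum_(j < (N - i).+1) F i j (N - i - j)%N.
Proof. by apply: eq_bigr => i _; rewrite sum_diag // -ltnS. Qed.

Lemma sum_tri_r F :
  \sum_(i < N.+1) \sum_(j < N.+1) \sum_(k < N.+1 | (i + j + k == N)%N) F i j k =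
  \sum_(k < N.+1) \sum_(i < (N - k).+1) F i (N - k - i)%N k.
Proof.
transitivity (\sum_(k < N.+1) \sum_(i < N.+1)
    \sum_(j < N.+1 | (k + i + j == N)%N) F i j k); last first.
  by apply: eq_bigr => k _; rewrite (sum_diag (fun i j => F i j k)) // -ltnS.
rewrite [RHS]exchange_big /=; apply: eq_bigr => i _.
rewrite [RHS](exchange_big_dep xpredT) //=; apply: eq_bigr => j _.
by apply: eq_bigl => k; rewrite addnC addnA.
Qed.

End TriangularSums.

Lemma sum_comb3 (K : comNzRingType) (M : nat) (c u v w z : nat -> K) A B C E :
  (forall k, A * u k + B * v k + C * w k = E * z k) ->
  A * (\sum_(k < M) c k * u k) + B * (\sum_(k < M) c k * v k)
    + C * (\sum_(k < M) c k * w k) = E * \sum_(k < M) c k * z k.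
Proof.
move=> H; elim: M => [|M IH]; first by rewrite !big_ord0 !mulr0 !addr0.
by rewrite !big_ord_recr /= [RHS]mulrDr -IH (mulrCA E) -H; ring.
Qed.

Section ThreeFold.
Variables (R : realType) (h : R[i]) (Delta : R[i] -> R[i] -> R[i] -> R[i]).
Hypothesis q_gen : forall n : nat, qnum h n.+1%:R != 0.
Local Notation qp := (qpow h).
Local Notation br := (qnum h).
Local Notation G := (wt3j h Delta).
Implicit Types (a mu : R[i]) (n : nat).

Variables mu1 mu2 mu3 : R[i].

Definition treeL mu12 mu a1 a2 a3 : R[i] :=
  G mu12 mu3 mu (a1 + a2) a3 * G mu1 mu2 mu12 a1 a2.
Definition treeR mu23 mu a1 a2 a3 : R[i] :=
  G mu1 mu23 mu a1 (a2 + a3) * G mu2 mu3 mu23 a2 a3.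

Implicit Types f g : R[i] -> R[i] -> R[i] -> R[i].

(** A function f collects the components of all [e^mu_a] at once, with a = a1 + a2 + a3. The
    equation is [E e_(a - 1) = [mu - a + 1] e_a], read at one basis tensor. *)
Definition E_eigen mu f : Prop := forall a1 a2 a3,
  br (mu1 - a1 + 1) * qp (2%:R * (a2 + a3)) * f (a1 - 1) a2 a3
  + br (mu2 - a2 + 1) * qp (2%:R * a3) * f a1 (a2 - 1) a3
  + br (mu3 - a3 + 1) * f a1 a2 (a3 - 1)
  = br (mu - (a1 + a2 + a3) + 1) * f a1 a2 a3.

Definition F_eigen mu f : Prop := forall a1 a2 a3, a1 + a2 + a3 != mu ->
  br (mu + (a1 + a2 + a3) + 1) * f a1 a2 a3 =
  br (mu1 + a1 + 1) * f (a1 + 1) a2 a3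
  + qp (- (2%:R * a1)) * br (mu2 + a2 + 1) * f a1 (a2 + 1) a3
  + qp (- (2%:R * (a1 + a2))) * br (mu3 + a3 + 1) * f a1 a2 (a3 + 1).

Definition lattice_supp mu f : Prop := forall a1 a2 a3,
  ~~ [&& isnat (mu1 - a1), isnat (mu2 - a2), isnat (mu3 - a3)
      & isnat (mu - (a1 + a2 + a3))] -> f a1 a2 a3 = 0.

(** The outer symbol depends on a1 and a2 only through a1 + a2, so by coassociativity the terms for
    factors 1 and 2 collapse under the inner recursion, and the rest is the outer recursion. *)
Lemma treeL_E mu12 mu : generic_weight h mu12 -> generic_weight h mu ->
  E_eigen mu (treeL mu12 mu).
Proof.
move=> g12 g a1 a2 a3; rewrite /treeL.
have e12 := wt3jE Delta q_gen mu1 mu2 a1 a2 g12.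
have e := wt3jE Delta q_gen mu12 mu3 (a1 + a2) a3 g.
have -> : a1 - 1 + a2 = a1 + a2 - 1 by ring.
have -> : a1 + (a2 - 1) = a1 + a2 - 1 by ring.
rewrite mulrDr qpowD.
transitivity (qp (2%:R * a3) * G mu12 mu3 mu (a1 + a2 - 1) a3 *
  (br (mu1 - a1 + 1) * qp (2%:R * a2) * G mu1 mu2 mu12 (a1 - 1) a2 +
   br (mu2 - a2 + 1) * G mu1 mu2 mu12 a1 (a2 - 1))
  + br (mu3 - a3 + 1) * G mu12 mu3 mu (a1 + a2) (a3 - 1) * G mu1 mu2 mu12 a1 a2).
  ring.
rewrite e12 [RHS]mulrA -e; ring.
Qed.

Lemma treeR_E mu23 mu : generic_weight h mu23 -> generic_weight h mu ->
  E_eigen mu (treeR mu23 mu).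
Proof.
move=> g23 g a1 a2 a3; rewrite /treeR.
have e23 := wt3jE Delta q_gen mu2 mu3 a2 a3 g23.
have e := wt3jE Delta q_gen mu1 mu23 a1 (a2 + a3) g.
have -> : a2 - 1 + a3 = a2 + a3 - 1 by ring.
have -> : a2 + (a3 - 1) = a2 + a3 - 1 by ring.
have -> : a1 + a2 + a3 = a1 + (a2 + a3) by ring.
transitivity (br (mu1 - a1 + 1) * qp (2%:R * (a2 + a3))
   * G mu1 mu23 mu (a1 - 1) (a2 + a3) * G mu2 mu3 mu23 a2 a3 +
  G mu1 mu23 mu a1 (a2 + a3 - 1) *
  (br (mu2 - a2 + 1) * qp (2%:R * a3) * G mu2 mu3 mu23 (a2 - 1) a3 +
   br (mu3 - a3 + 1) * G mu2 mu3 mu23 a2 (a3 - 1))).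
  ring.
rewrite e23 [RHS]mulrA -e; ring.
Qed.

Lemma wt3j_above_l m1 m2 mu a : G m1 m2 mu (m1 + 1) a = 0.
Proof.
by rewrite wt3j_eq0l // opprD addNKr; exact: (isnatN1 _ 0).
Qed.

Lemma wt3j_above_r m1 m2 mu a : G m1 m2 mu a (m2 + 1) = 0.
Proof.
by rewrite wt3j_eq0r // opprD addNKr; exact: (isnatN1 _ 0).
Qed.

Lemma treeL_F mu12 mu : generic_weight h mu12 -> generic_weight h mu ->
  F_eigen mu (treeL mu12 mu).
Proof.
move=> g12 g a1 a2 a3 ne; rewrite /treeL.
have e := wt3jF Delta q_gen mu12 mu3 g ne.
rewrite mulrA e.
have e12 : G mu12 mu3 mu (a1 + a2 + 1) a3 *
    (br (mu12 + (a1 + a2) + 1) * G mu1 mu2 mu12 a1 a2) =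
  G mu12 mu3 mu (a1 + a2 + 1) a3 * (br (mu1 + a1 + 1) * G mu1 mu2 mu12 (a1 + 1) a2
  + qp (- (2%:R * a1)) * br (mu2 + a2 + 1) * G mu1 mu2 mu12 a1 (a2 + 1)).
  (* The inner recursion fails exactly at a1 + a2 = mu12, where the outer symbol, taken at mu12 + 1,
     vanishes. *)
  have [->|n12] := eqVneq (a1 + a2) mu12; first by rewrite wt3j_above_l !mul0r.
  by rewrite (wt3jF Delta q_gen mu1 mu2 g12 n12).
have -> : a1 + 1 + a2 = a1 + a2 + 1 by ring.
have -> : a1 + (a2 + 1) = a1 + a2 + 1 by ring.
transitivity (G mu12 mu3 mu (a1 + a2 + 1) a3 *
    (br (mu12 + (a1 + a2) + 1) * G mu1 mu2 mu12 a1 a2)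
  + qp (- (2%:R * (a1 + a2))) * br (mu3 + a3 + 1)
    * G mu12 mu3 mu (a1 + a2) (a3 + 1) * G mu1 mu2 mu12 a1 a2); first by ring.
rewrite e12; ring.
Qed.

Lemma treeR_F mu23 mu : generic_weight h mu23 -> generic_weight h mu ->
  F_eigen mu (treeR mu23 mu).
Proof.
move=> g23 g a1 a2 a3; rewrite /treeR.
have -> : a1 + a2 + a3 = a1 + (a2 + a3) by ring.
move=> ne; have e := wt3jF Delta q_gen mu1 mu23 g ne.
rewrite mulrA e.
have e23 : G mu1 mu23 mu a1 (a2 + a3 + 1) *
    (br (mu23 + (a2 + a3) + 1) * G mu2 mu3 mu23 a2 a3) =
  G mu1 mu23 mu a1 (a2 + a3 + 1) * (br (mu2 + a2 + 1) * G mu2 mu3 mu23 (a2 + 1) a3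
  + qp (- (2%:R * a2)) * br (mu3 + a3 + 1) * G mu2 mu3 mu23 a2 (a3 + 1)).
  have [->|n23] := eqVneq (a2 + a3) mu23; first by rewrite wt3j_above_r !mul0r.
  by rewrite (wt3jF Delta q_gen mu2 mu3 g23 n23).
have -> : a2 + 1 + a3 = a2 + a3 + 1 by ring.
have -> : a2 + (a3 + 1) = a2 + a3 + 1 by ring.
transitivity (br (mu1 + a1 + 1) * G mu1 mu23 mu (a1 + 1) (a2 + a3)
    * G mu2 mu3 mu23 a2 a3 +
  qp (- (2%:R * a1)) * (G mu1 mu23 mu a1 (a2 + a3 + 1) *
    (br (mu23 + (a2 + a3) + 1) * G mu2 mu3 mu23 a2 a3))); first by ring.
rewrite e23 (mulrDr _ a1) opprD (qpowD h (- (2%:R * a1))); ring.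
Qed.

Lemma treeL_supp mu12 mu : lattice_supp mu (treeL mu12 mu).
Proof.
move=> a1 a2 a3; rewrite /treeL.
case: (boolP (isnat (mu1 - a1))) => [_|n1]; last by rewrite (wt3j_eq0l _ _ _ _ _ n1) mulr0.
case: (boolP (isnat (mu2 - a2))) => [_|n2]; last by rewrite (wt3j_eq0r _ _ _ _ _ n2) mulr0.
case: (boolP (isnat (mu3 - a3))) => [_|n3]; last by rewrite (wt3j_eq0r _ _ _ _ _ n3) mul0r.
by move=> /= nt; rewrite (wt3j_eq0t _ _ _ _ nt) mul0r.
Qed.

Lemma treeR_supp mu23 mu : lattice_supp mu (treeR mu23 mu).
Proof.
move=> a1 a2 a3; rewrite /treeR.
case: (boolP (isnat (mu1 - a1))) => [_|n1]; last by rewrite (wt3j_eq0l _ _ _ _ _ n1) mul0r.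
case: (boolP (isnat (mu2 - a2))) => [_|n2]; last by rewrite (wt3j_eq0l _ _ _ _ _ n2) mulr0.
case: (boolP (isnat (mu3 - a3))) => [_|n3]; last by rewrite (wt3j_eq0r _ _ _ _ _ n3) mulr0.
by rewrite -addrA => /= nt; rewrite (wt3j_eq0t _ _ _ _ nt) mul0r.
Qed.

Section Combination.
Variables (mu : R[i]) (f : R[i] -> R[i] -> R[i] -> R[i]) (M : nat) (c : nat -> R[i]).
Variable fs : nat -> R[i] -> R[i] -> R[i] -> R[i].
Let D a1 a2 a3 := f a1 a2 a3 - \sum_(k < M) c k * fs k a1 a2 a3.

(** The recursions are linear, with coefficients fixed by the end weight mu. They therefore apply to
    the difference between a tree and its candidate expansion, which can then be shown to vanish. *)
Lemma E_eigen_comb : E_eigen mu f -> (forall k, E_eigen mu (fs k)) -> E_eigen mu D.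
Proof.
move=> Ef Efs a1 a2 a3; have e := Ef a1 a2 a3.
have es k := Efs k a1 a2 a3; rewrite /D; move: e es.
move: (br (mu - _ + 1)) (br (mu3 - _ + 1)) => E C.
move: (br (mu1 - _ + 1) * qp _) (br (mu2 - _ + 1) * qp _) => A B e es.
have ss := sum_comb3 M c es.
by rewrite [RHS]mulrBr -e -ss; ring.
Qed.

Lemma F_eigen_comb : F_eigen mu f -> (forall k, F_eigen mu (fs k)) -> F_eigen mu D.
Proof.
move=> Ff Ffs a1 a2 a3 ne; have e := Ff a1 a2 a3 ne.
have es k := Ffs k a1 a2 a3 ne; rewrite /D; move: e es.
move: (br (mu + _ + 1)) (br (mu1 + _ + 1)) => E A.
move: (qp _ * br (mu2 + _ + 1)) (qp _ * br (mu3 + _ + 1)) => B C e es.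
have ss := sum_comb3 M c (fun k => esym (es k)).
by rewrite [LHS]mulrBr e -ss; ring.
Qed.

Lemma lattice_supp_comb : lattice_supp mu f -> (forall k, lattice_supp mu (fs k)) ->
  lattice_supp mu D.
Proof.
move=> Sf Sfs a1 a2 a3 n; rewrite /D Sf // big1 ?subr0 // => k _.
by rewrite Sfs // mulr0.
Qed.

End Combination.

(** Solved for its middle term, the recursion expresses components at depth n + 1 of factor 2
    through components at depth n, the coefficient [[n + 1]_q] being nonzero. *)
Lemma E_eigen_mid mu f n : E_eigen mu f -> (forall a1 a3, f a1 mu2 a3 = 0) ->
  forall a1 a3, f a1 (mu2 - n%:R) a3 = 0.
Proof.
move=> Ef f0; elim: n => [|n IH] a1 a3; first by rewrite subr0.
have := Ef a1 (mu2 - n%:R) a3.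
rewrite !IH !mulr0 add0r addr0.
have -> : mu2 - (mu2 - n%:R) + 1 = n.+1%:R by rewrite -natr1; ring.
have -> : mu2 - n%:R - 1 = mu2 - n.+1%:R by rewrite -natr1; ring.
by move=> e; apply: (mulfI (mulf_neq0 (q_gen n) (qpow_neq0 h _))); rewrite mulr0; exact: e.
Qed.

(* At total weight [mu] the vector is singular, so it is determined by its
   components with [a1] highest; [F] then reaches all lower weights. *)
Lemma eigen_eq0 mu f : generic_weight h mu ->
  E_eigen mu f -> F_eigen mu f -> lattice_supp mu f ->
  (forall a2 a3, mu1 + a2 + a3 = mu -> f mu1 a2 a3 = 0) ->
  forall a1 a2 a3, f a1 a2 a3 = 0.
Proof.
move=> g Ef Ff Sf f0 a1 a2 a3.
have [/and4P[_ _ _ /isnatP[m Em]]|] :=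
    boolP [&& isnat (mu1 - a1), isnat (mu2 - a2), isnat (mu3 - a3)
      & isnat (mu - (a1 + a2 + a3))]; last exact: Sf.
elim: m a1 a2 a3 Em => [|m IH] a1 a2 a3 Em.
  have [/and4P[/isnatP[n En] _ _ _]|] :=
    boolP [&& isnat (mu1 - a1), isnat (mu2 - a2), isnat (mu3 - a3)
      & isnat (mu - (a1 + a2 + a3))]; last exact: Sf.
  have -> : a1 = mu1 - n%:R by rewrite -En; ring.
  have {En Em} : mu1 - n%:R + a2 + a3 = mu.
    by rewrite -En -[RHS](subrK (a1 + a2 + a3)) Em; ring.
  elim: n a2 a3 {a1} => [|n IH] a2 a3.
    by rewrite subr0; exact: f0.
  move=> e; have := Ef (mu1 - n%:R) a2 a3.
  rewrite (IH (a2 - 1) a3); last by rewrite -e -natr1; ring.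
  rewrite (IH a2 (a3 - 1)); last by rewrite -e -natr1; ring.
  have -> : mu - (mu1 - n%:R + a2 + a3) + 1 = 0 by rewrite -e -natr1; ring.
  have -> : mu1 - (mu1 - n%:R) + 1 = n.+1%:R by rewrite -natr1; ring.
  have -> : mu1 - n%:R - 1 = mu1 - n.+1%:R by rewrite -natr1; ring.
  rewrite qnum0 mul0r !mulr0 !addr0 => e'.
  by apply: (mulfI (mulf_neq0 (q_gen n) (qpow_neq0 h _))); rewrite mulr0; exact: e'.
have ne : a1 + a2 + a3 != mu.
  by rewrite eq_sym -subr_eq0 Em pnatr_eq0.
have := Ff a1 a2 a3 ne.
rewrite (IH (a1 + 1)); last by rewrite -[m%:R](addrK 1) natr1 -Em; ring.
rewrite (IH a1 (a2 + 1)); last by rewrite -[m%:R](addrK 1) natr1 -Em; ring.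
rewrite (IH a1 a2 (a3 + 1)); last by rewrite -[m%:R](addrK 1) natr1 -Em; ring.
have -> : mu + (a1 + a2 + a3) + 1 = 2%:R * mu - m%:R.
  by rewrite -[m%:R](addrK 1) natr1 -Em; ring.
by rewrite !mulr0 !addr0 => e; apply: (mulfI (g m)); rewrite mulr0; exact: e.
Qed.

End ThreeFold.

(** * From vectors of the free module to functions of weights *)

Section TensorCoefficients.
Variable R : realType.
Implicit Types (a : R[i]).

Lemma tens3_sum_coef mu1 mu2 mu3 a (f : R[i] -> R[i] -> R[i] -> R[i])
    (n1 n2 n3 : nat) :
  (tens3_sum mu1 mu2 mu3 a f)@_(n1, n2, n3) =
  if mu1 + mu2 + mu3 - a == (n1 + n2 + n3)%:R then
    f (mu1 - n1%:R) (mu2 - n2%:R) (mu3 - n3%:R) else 0.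
Proof.
rewrite /tens3_sum; case: (boolP (isnat _)) => [/isnatP[n ->]|nn]; last first.
  by rewrite mcoeff0 ifF //; apply: contraNF nn => /eqP ->; exact: isnat_nat.
rewrite natC_nat eqr_nat raddf_sum /=.
rewrite (eq_bigr (fun m1 : 'I_n.+1 => \sum_(m2 < n.+1)
   \sum_(m3 < n.+1 | (m1 + m2 + m3 == n)%N)
     (if [&& m1 == n1 :> nat, m2 == n2 :> nat & m3 == n3 :> nat] then
       f (mu1 - n1%:R) (mu2 - n2%:R) (mu3 - n3%:R) else 0))); last first.
  move=> m1 _; rewrite raddf_sum; apply: eq_bigr => m2 _.
  rewrite raddf_sum; apply: eq_bigr => m3 _ /=.
  rewrite mcoeffU !xpair_eqE -andbA.
  by case: and3P => [[/eqP -> /eqP -> /eqP ->]|].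
have [en|ne] := eqVneq n (n1 + n2 + n3)%N; last first.
  rewrite !big1 // => m1 _; rewrite big1 // => m2 _; rewrite big1 // => m3 /eqP e.
  by case: and3P => // -[/eqP e1 /eqP e2 /eqP e3]; case/eqP: ne; lia.
have l1 : (n1 < n.+1)%N by lia.
have l2 : (n2 < n.+1)%N by lia.
have l3 : (n3 < n.+1)%N by lia.
rewrite (bigD1 (Ordinal l1)) //= [X in _ + X]big1 ?addr0; last first.
  move=> m1 n1'; rewrite big1 // => m2 _; rewrite big1 // => m3 _.
  by rewrite ifF //; apply/negbTE; apply: contraNN n1' => /and3P[/eqP e _ _];
     apply/eqP/val_inj.
rewrite (bigD1 (Ordinal l2)) //= [X in _ + X]big1 ?addr0; last first.
  move=> m2 n2'; rewrite big1 // => m3 _.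
  by rewrite ifF //; apply/negbTE; apply: contraNN n2' => /and3P[_ /eqP e _];
     apply/eqP/val_inj.
rewrite (bigD1 (Ordinal l3)) /=; last by apply/eqP.
rewrite !eqxx /= [X in _ + X]big1 ?addr0 // => m3 /andP[_ n3'].
by rewrite ifF //; apply/negbTE; apply: contraNN n3' => /eqP e;
   apply/eqP/val_inj.
Qed.

End TensorCoefficients.

(** * Change of basis between left-nested and right-nested trees *)

Section Recoupling.
Variables (R : realType) (h : R[i]) (Delta : R[i] -> R[i] -> R[i] -> R[i]).
Hypothesis q_gen : forall n : nat, qnum h n.+1%:R != 0.
Hypothesis DeltaP : Delta_choice h Delta.
Local Notation G := (wt3j h Delta).
Local Notation vnorm := (vnorm h).
Implicit Types (a : R[i]).

Variables (mu1 mu2 mu3 : R[i]) (N : nat).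
Hypotheses (g1 : generic_weight h mu1) (g2 : generic_weight h mu2).
Hypotheses (g3 : generic_weight h mu3) (g12 : generic_weight h (mu1 + mu2)).
Hypotheses (g23 : generic_weight h (mu2 + mu3)).
Hypothesis (g123 : generic_weight h (mu1 + mu2 + mu3)).

Let mu := mu1 + mu2 + mu3 - N%:R.
Let tL p := treeL h Delta mu1 mu2 mu3 (mu1 + mu2 - p%:R) mu.
Let tR k := treeR h Delta mu1 mu2 mu3 (mu2 + mu3 - k%:R) mu.

Let gmu : generic_weight h mu. Proof. exact: generic_weightB. Qed.

(** The indicator corrects for truncated subtraction: for k > N - i the depth [N - i - k] reads as 0
    and [nat3j] need not vanish, while the symbol on the left does. *)
Let wtR (k i : nat) : (k <= N)%N -> (i <= N)%N ->
  G mu1 (mu2 + mu3 - k%:R) mu (mu1 - i%:R) (mu2 + mu3 - (N - i)%:R) =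
  nat3j h Delta mu1 (mu2 + mu3 - k%:R) (N - k) i (N - i - k) * (k <= N - i)%:R.
Proof.
move=> lek lei; rewrite /nat3j.
have [le|lt] := leqP k (N - i).
  rewrite mulr1; congr (wt3j _ _ _ _ _ _ _).
    by rewrite /mu (natrB _ lek); ring.
  by rewrite (natrB _ le); ring.
rewrite mulr0 wt3j_eq0r //.
have -> : mu2 + mu3 - k%:R - (mu2 + mu3 - (N - i)%:R) = (N - i)%:R - k%:R.
  by ring.
by apply/negP => /isnat_subn; rewrite leqNgt lt.
Qed.

Let g1_23 k : generic_weight h (mu1 + (mu2 + mu3 - k%:R)).
Proof. by rewrite !addrA; exact: generic_weightB. Qed.

Let g12_3 k : generic_weight h (mu1 + mu2 - k%:R + mu3).
Proof. by rewrite addrAC; exact: generic_weightB. Qed.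

(** With a1 highest and total weight mu, the tree [tR k] is the nonzero number [s k] times a
    3j-symbol of factors 2 and 3. [complete2] expands the components of [tL p] in those symbols,
    dividing by [s k] gives the coefficients, and [eigen_eq0] extends the equality to all
    weights. *)
Lemma recoupling_ex (p : nat) : exists c : nat -> R[i], forall a1 a2 a3,
  tL p a1 a2 a3 = \sum_(k < N.+1) c k * tR k a1 a2 a3.
Proof.
have [x xP] := complete2 q_gen DeltaP N
  (fun i => tL p mu1 (mu2 - i%:R) (mu3 - (N - i)%:R)) g2 g3 g23.
pose s k := G mu1 (mu2 + mu3 - k%:R) mu mu1 (mu2 + mu3 - N%:R).
have s0 k : (k <= N)%N -> s k != 0.
  move=> le; have := wtR le (leq0n N); rewrite !subn0 subr0 le mulr1 /s => ->.
  exact: (nat3j_top q_gen DeltaP (N - k) g1 (generic_weightB k g23) (g1_23 k)).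
pose c k := x k / s k; exists c => a1 a2 a3; apply/eqP; rewrite -subr_eq0; apply/eqP.
move: a1 a2 a3; apply: (eigen_eq0 q_gen gmu).
- apply: (@E_eigen_comb _ _ _ _ _ _ (tL p) N.+1 c tR) => [|k].
    exact: (treeL_E Delta q_gen mu1 mu2 mu3 (generic_weightB p g12) gmu).
  exact: (treeR_E Delta q_gen mu1 mu2 mu3 (generic_weightB k g23) gmu).
- apply: (@F_eigen_comb _ _ _ _ _ _ (tL p) N.+1 c tR) => [|k].
    exact: (treeL_F Delta q_gen mu1 mu2 mu3 (generic_weightB p g12) gmu).
  exact: (treeR_F Delta q_gen mu1 mu2 mu3 (generic_weightB k g23) gmu).
- apply: (@lattice_supp_comb _ _ _ _ _ (tL p) N.+1 c tR) => [|k]; first exact: treeL_supp.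
  exact: treeR_supp.
move=> a2 a3 e.
have [/and4P[_ /isnatP[i Ei] /isnatP[j Ej] _]|nl] :=
  boolP [&& isnat (mu1 - mu1), isnat (mu2 - a2), isnat (mu3 - a3)
      & isnat (mu - (mu1 + a2 + a3))]; last first.
  rewrite /tL treeL_supp // big1 ?subr0 // => k _.
  by rewrite /tR treeR_supp // mulr0.
have ij : (i + j = N)%N.
  by apply: (@natrI R); rewrite natrD -Ei -Ej -[N%:R](subKr (mu1 + mu2 + mu3))
    -/mu -e; ring.
have -> : a2 = mu2 - i%:R by rewrite -Ei; ring.
have -> : a3 = mu3 - (N - i)%:R by rewrite -ij addKn -Ej; ring.
rewrite xP; last by rewrite -ij leq_addr.
apply/eqP; rewrite subr_eq0; apply/eqP; apply: eq_bigr => k _.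
have lek : (k <= N)%N by rewrite -ltnS.
rewrite /tR /treeR.
have -> : mu2 - i%:R + (mu3 - (N - i)%:R) = mu2 + mu3 - N%:R.
  by rewrite -ij addKn natrD; ring.
by rewrite -/(s k) /c mulrA divfK ?s0.
Qed.

(** The form is taken on the weight space of weight mu, where the trees with end weight mu have
    their singular vectors. *)
Definition dot3 (f g : R[i] -> R[i] -> R[i] -> R[i]) : R[i] :=
  \sum_(i < N.+1) \sum_(j < N.+1) \sum_(k < N.+1 | (i + j + k == N)%N)
    vnorm mu1 i * vnorm mu2 j * vnorm mu3 k
    * f (mu1 - i%:R) (mu2 - j%:R) (mu3 - k%:R)
    * g (mu1 - i%:R) (mu2 - j%:R) (mu3 - k%:R).

(** Summing over factors 2 and 3 first gives, by [orth2], the Kronecker symbol and the norms of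
    M_mu23; what remains is the norm of a singular vector in the tensor product of M_mu1 and
    M_mu23. *)
Lemma dot3R q q' : (q <= N)%N -> (q' <= N)%N ->
  dot3 (tR q) (tR q') = if q == q' then vnorm mu 0 else 0.
Proof.
move=> leq leq'; rewrite /dot3 (sum_tri_l N (fun i j k : nat =>
    vnorm mu1 i * vnorm mu2 j * vnorm mu3 k
    * tR q (mu1 - i%:R) (mu2 - j%:R) (mu3 - k%:R)
    * tR q' (mu1 - i%:R) (mu2 - j%:R) (mu3 - k%:R))).
pose s k i := G mu1 (mu2 + mu3 - k%:R) mu (mu1 - i%:R) (mu2 + mu3 - (N - i)%:R).
transitivity (\sum_(i < N.+1) vnorm mu1 i * s q i * s q' i *
    dot2 h mu2 mu3 (N - i) (nat3j h Delta mu2 mu3 q) (nat3j h Delta mu2 mu3 q')).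
  apply: eq_bigr => i _; rewrite /dot2 mulr_sumr; apply: eq_bigr => j _.
  have lej : (j <= N - i)%N by rewrite -ltnS.
  rewrite /tR /treeR.
  have -> : mu2 - j%:R + (mu3 - (N - i - j)%:R) = mu2 + mu3 - (N - i)%:R.
    by rewrite (natrB _ lej); ring.
  by rewrite -/(s q i) -/(s q' i) -!/(nat3j _ _ _ _ _ _ _); ring.
have [<-|ne] := eqVneq q q'; last first.
  rewrite big1 // => i _; rewrite (orth2 q_gen DeltaP g2 g3 g23) (negbTE ne) /=.
  by rewrite mulr0.
have -> : vnorm mu 0 = vnorm (mu1 + (mu2 + mu3 - q%:R) - (N - q)%:R) 0.
  by congr vnorm; rewrite /mu (natrB _ leq); ring.
rewrite -(norm_sing q_gen DeltaP (N - q) g1 (generic_weightB q g23) (g1_23 q)).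
pose t i := nat3j h Delta mu1 (mu2 + mu3 - q%:R) (N - q) i (N - q - i).
have leN : ((N - q).+1 <= N.+1)%N by rewrite ltnS leq_subr.
rewrite [in RHS]/dot2 (big_ord_widen_cond _ predT (fun i => vnorm mu1 i
  * vnorm (mu2 + mu3 - q%:R) (N - q - i) * t i * t i) leN) [RHS]big_mkcond /=.
apply: eq_bigr => i _; rewrite (orth2 q_gen DeltaP g2 g3 g23) eqxx /= ltnS.
have lei : (i <= N)%N by rewrite -ltnS.
have eqle : (q <= N - i)%N = (i <= N - q)%N by lia.
rewrite /s wtR // eqle; case: ifP => [le|_]; last by rewrite mulr0.
by rewrite mulr1 subnAC /t; ring.
Qed.

Lemma dot3L p p' : (p <= N)%N -> (p' <= N)%N ->
  dot3 (tL p) (tL p') = if p == p' then vnorm mu 0 else 0.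
Proof.
move=> lep lep'; rewrite /dot3 (sum_tri_r N (fun i j k : nat =>
    vnorm mu1 i * vnorm mu2 j * vnorm mu3 k
    * tL p (mu1 - i%:R) (mu2 - j%:R) (mu3 - k%:R)
    * tL p' (mu1 - i%:R) (mu2 - j%:R) (mu3 - k%:R))).
pose s q k := G (mu1 + mu2 - q%:R) mu3 mu (mu1 + mu2 - (N - k)%:R) (mu3 - k%:R).
transitivity (\sum_(k < N.+1) vnorm mu3 k * s p k * s p' k *
    dot2 h mu1 mu2 (N - k) (nat3j h Delta mu1 mu2 p) (nat3j h Delta mu1 mu2 p')).
  apply: eq_bigr => k _; rewrite /dot2 mulr_sumr; apply: eq_bigr => i _.
  have lei : (i <= N - k)%N by rewrite -ltnS.
  rewrite /tL /treeL.
  have -> : mu1 - i%:R + (mu2 - (N - k - i)%:R) = mu1 + mu2 - (N - k)%:R.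
    by rewrite (natrB _ lei); ring.
  by rewrite -/(s p k) -/(s p' k) -!/(nat3j _ _ _ _ _ _ _); ring.
have [<-|ne] := eqVneq p p'; last first.
  rewrite big1 // => i _; rewrite (orth2 q_gen DeltaP g1 g2 g12) (negbTE ne) /=.
  by rewrite mulr0.
have emu : mu = mu1 + mu2 - p%:R + mu3 - (N - p)%:R.
  by rewrite /mu (natrB _ lep); ring.
rewrite [in RHS]emu.
rewrite -(norm_sing q_gen DeltaP (N - p) (generic_weightB p g12) g3 (g12_3 p)).
pose t k := nat3j h Delta (mu1 + mu2 - p%:R) mu3 (N - p) (N - p - k) k.
have leN : ((N - p).+1 <= N.+1)%N by rewrite ltnS leq_subr.
pose F k := vnorm (mu1 + mu2 - p%:R) (N - p - k) * vnorm mu3 k * t k * t k.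
transitivity (\sum_(k < (N - p).+1) F k); last first.
  (* The form on the pair (12), 3 is summed over the depth of (12), the triangular sum over that of
     factor 3: the index is reversed. *)
  rewrite /dot2 (reindex_inj rev_ord_inj) /=; apply: eq_bigr => k _.
  have lek : (k <= N - p)%N by rewrite -ltnS.
  by rewrite subSS /F /t subKn.
rewrite (big_ord_widen_cond _ predT F leN) [RHS]big_mkcond /=.
apply: eq_bigr => k _; rewrite (orth2 q_gen DeltaP g1 g2 g12) eqxx /= ltnS.
have lek : (k <= N)%N by rewrite -ltnS.
have eqle : (p <= N - k)%N = (k <= N - p)%N by lia.
rewrite eqle; case: ifP => [le|_]; last by rewrite mulr0.
have -> : s p k = t k.
  rewrite /s /t /nat3j; congr wt3j; first exact: emu.
  by rewrite (natrB _ le) (natrB _ lep) (natrB _ lek); ring.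
by rewrite /F subnAC; ring.
Qed.

Lemma dot3_suml (M : nat) (d : nat -> R[i])
    (fs : nat -> R[i] -> R[i] -> R[i] -> R[i]) g :
  dot3 (fun a1 a2 a3 => \sum_(k < M) d k * fs k a1 a2 a3) g =
  \sum_(k < M) d k * dot3 (fs k) g.
Proof.
rewrite /dot3; under [RHS]eq_bigr do rewrite mulr_sumr.
rewrite [RHS]exchange_big /=; apply: eq_bigr => i _.
under [RHS]eq_bigr do rewrite mulr_sumr.
rewrite [RHS]exchange_big /=; apply: eq_bigr => j _.
under [RHS]eq_bigr do rewrite mulr_sumr.
rewrite [RHS]exchange_big /=; apply: eq_bigr => m _.
by rewrite mulr_sumr mulr_suml; apply: eq_bigr => k _; ring.
Qed.

Lemma dot3C f g : dot3 f g = dot3 g f.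
Proof.
by apply: eq_bigr => i _; apply: eq_bigr => j _; apply: eq_bigr => k _; rewrite mulrAC.
Qed.

(** Both families of trees are orthogonal with the same norm [vnorm mu 0], so the matrix of c
    satisfies C C^T = 1 without diagonal corrections, and its inverse is C^T. *)
Lemma recoupling_inv (c : nat -> nat -> R[i]) :
  (forall p a1 a2 a3,
    tL p a1 a2 a3 = \sum_(k < N.+1) c p k * tR k a1 a2 a3) ->
  forall q, (q <= N)%N -> forall a1 a2 a3,
    tR q a1 a2 a3 = \sum_(p < N.+1) c p q * tL p a1 a2 a3.
Proof.
move=> cP; have v0 : vnorm mu 0 != 0 by exact: vnorm_neq0.
have lin p p' : dot3 (tL p) (tL p') = \sum_(k < N.+1) \sum_(l < N.+1)
    c p k * c p' l * dot3 (tR k) (tR l).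
  have tLE r : tL r = fun a1 a2 a3 => \sum_(k < N.+1) c r k * tR k a1 a2 a3.
    by apply/funext => a1; apply/funext => a2; apply/funext => a3.
  rewrite [in LHS](tLE p) dot3_suml; apply: eq_bigr => k _.
  rewrite dot3C (tLE p') dot3_suml mulr_sumr; apply: eq_bigr => l _.
  by rewrite mulrA dot3C.
pose C := \matrix_(p < N.+1, k < N.+1) c p k.
have CCt : C *m C^T = 1%:M.
  apply/matrixP => p p'; rewrite !mxE.
  have lep : (p <= N)%N by rewrite -ltnS.
  have lep' : (p' <= N)%N by rewrite -ltnS.
  apply: (mulIf v0); rewrite mulr_suml -val_eqE /=.
  have := lin p p'; rewrite dot3L // => e.
  transitivity (if val p == p' then vnorm mu 0 else 0); last first.
    by case: eqP; rewrite ?mul1r ?mul0r.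
  rewrite e; apply: eq_bigr => k _; rewrite !mxE.
  have lek : (k <= N)%N by rewrite -ltnS.
  rewrite (bigD1 k) //= big1 ?addr0 => [|l ne]; rewrite dot3R ?eqxx // -1?ltnS //.
  by rewrite ifF ?mulr0 // eq_sym; exact: negbTE.
have CtC := mulmx1C CCt.
move=> q leq a1 a2 a3.
transitivity (\sum_(k < N.+1) (\sum_(p < N.+1) c p q * c p k) * tR k a1 a2 a3).
  have ltq : (q < N.+1)%N by rewrite ltnS.
  have ortho (k : 'I_N.+1) : \sum_(p < N.+1) c p q * c p k = (q == k)%:R.
    have /matrixP/(_ (Ordinal ltq) k) := CtC; rewrite !mxE -val_eqE /= => <-.
    by apply: eq_bigr => p _; rewrite !mxE.
  under eq_bigr do rewrite ortho.
  rewrite (bigD1 (Ordinal ltq)) //= eqxx mul1r big1 ?addr0 // => k ne.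
  by rewrite (_ : (q == k) = false) ?mul0r //; apply: contraNF ne => /eqP e;
     apply/eqP/val_inj.
under eq_bigr do rewrite mulr_suml.
rewrite exchange_big /=; apply: eq_bigr => p _.
by rewrite cP mulr_sumr; apply: eq_bigr => k _; rewrite mulrA.
Qed.

Lemma dot3_eq0 f g :
  (forall i j k : nat, (i + j + k = N)%N ->
     f (mu1 - i%:R) (mu2 - j%:R) (mu3 - k%:R) = 0) -> dot3 f g = 0.
Proof.
move=> f0; rewrite /dot3 big1 // => i _; rewrite big1 // => j _.
by rewrite big1 // => k /eqP e; rewrite f0 // mulr0 mul0r.
Qed.

(** Pairing with [tR q] isolates d q. Independence already at the weight mu makes the 6j-symbols
    well defined. *)
Lemma treeR_free (d : nat -> R[i]) :
  (forall i j k : nat, (i + j + k = N)%N ->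
     \sum_(q < N.+1) d q * tR q (mu1 - i%:R) (mu2 - j%:R) (mu3 - k%:R) = 0) ->
  forall q, (q <= N)%N -> d q = 0.
Proof.
move=> d0 q leq; have v0 : vnorm mu 0 != 0 by exact: vnorm_neq0.
have ltq : (q < N.+1)%N by rewrite ltnS.
have := @dot3_eq0 (fun a1 a2 a3 => \sum_(k < N.+1) d k * tR k a1 a2 a3) (tR q) d0.
rewrite (dot3_suml N.+1 d tR) (bigD1 (Ordinal ltq)) //= dot3R // eqxx.
rewrite big1 ?addr0 => [e|k ne]; first by apply: (mulIf v0); rewrite mul0r.
rewrite dot3R // -1?ltnS // ifF ?mulr0 //.
by apply: contraNF ne => /eqP e; apply/eqP/val_inj.
Qed.

Lemma treeL_free (d : nat -> R[i]) :
  (forall i j k : nat, (i + j + k = N)%N ->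
     \sum_(q < N.+1) d q * tL q (mu1 - i%:R) (mu2 - j%:R) (mu3 - k%:R) = 0) ->
  forall q, (q <= N)%N -> d q = 0.
Proof.
move=> d0 q leq; have v0 : vnorm mu 0 != 0 by exact: vnorm_neq0.
have ltq : (q < N.+1)%N by rewrite ltnS.
have := @dot3_eq0 (fun a1 a2 a3 => \sum_(k < N.+1) d k * tL k a1 a2 a3) (tL q) d0.
rewrite (dot3_suml N.+1 d tL) (bigD1 (Ordinal ltq)) //= dot3L // eqxx.
rewrite big1 ?addr0 => [e|k ne]; first by apply: (mulIf v0); rewrite mul0r.
rewrite dot3L // -1?ltnS // ifF ?mulr0 //.
by apply: contraNF ne => /eqP e; apply/eqP/val_inj.
Qed.

End Recoupling.

(** * The 6j-symbols *)

Lemma sum_shift (V : nmodType) (s N M : nat) (F : nat -> V) : (s + N <= M)%N ->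
  (forall p, (p < s)%N -> F p = 0) -> (forall p, (s + N < p)%N -> F p = 0) ->
  \sum_(p < M.+1) F p = \sum_(p < N.+1) F (s + p)%N.
Proof.
move=> le lo hi; rewrite -(big_mkord predT F).
rewrite (@big_cat_nat _ _ _ s) //=; last by lia.
rewrite (@big_cat_nat _ _ _ (N.+1 + s)%N s) //=; [|lia|lia].
rewrite big_nat_cond big1 ?add0r; last by move=> p; rewrite andbT => /lo.
rewrite [X in _ + X]big_nat_cond [X in _ + X]big1 ?addr0; last first.
  by move=> p; rewrite andbT => /andP[l _]; apply: hi; lia.
rewrite -{1}[s]add0n big_addn addnK big_mkord.
by apply: eq_bigr => p _; rewrite addnC.
Qed.

Section SixJ.
Variables (R : realType) (h : R[i]) (Delta : R[i] -> R[i] -> R[i] -> R[i]).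
Hypothesis q_gen : forall n : nat, qnum h n.+1%:R != 0.
Hypothesis DeltaP : Delta_choice h Delta.
Implicit Types (a : R[i]).

Lemma e12_coef mu1 mu2 mu3 mu12 mu a (n1 n2 n3 : nat) :
  (e12 h Delta mu1 mu2 mu3 mu12 mu a)@_(n1, n2, n3) =
  if mu1 + mu2 + mu3 - a == (n1 + n2 + n3)%:R then
    treeL h Delta mu1 mu2 mu3 mu12 mu (mu1 - n1%:R) (mu2 - n2%:R) (mu3 - n3%:R)
  else 0.
Proof.
rewrite tens3_sum_coef; case: eqP => // e; rewrite /treeL /wt3j.
congr (q3j _ _ _ _ _ _ _ _ * _).
by rewrite -[LHS](subKr (mu1 + mu2 + mu3)) e !natrD; ring.
Qed.

Lemma e23_coef mu1 mu2 mu3 mu23 mu a (n1 n2 n3 : nat) :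
  (e23 h Delta mu1 mu2 mu3 mu23 mu a)@_(n1, n2, n3) =
  if mu1 + mu2 + mu3 - a == (n1 + n2 + n3)%:R then
    treeR h Delta mu1 mu2 mu3 mu23 mu (mu1 - n1%:R) (mu2 - n2%:R) (mu3 - n3%:R)
  else 0.
Proof.
rewrite tens3_sum_coef; case: eqP => // e; rewrite /treeR /wt3j.
congr (q3j _ _ _ _ _ _ _ _ * _).
by rewrite -[LHS](subKr (mu1 + mu2 + mu3)) e !natrD; ring.
Qed.

Section Values.
Variables (mu1 mu2 mu3 : R[i]).
Hypotheses (g1 : generic_weight h mu1) (g2 : generic_weight h mu2).
Hypotheses (g3 : generic_weight h mu3) (g12 : generic_weight h (mu1 + mu2)).
Hypotheses (g23 : generic_weight h (mu2 + mu3)).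
Hypothesis (g123 : generic_weight h (mu1 + mu2 + mu3)).

(** The 6j-symbol is a chosen value among all admissible coefficient families. The given c provides
    one such family, and any other agrees with it by comparison of the singular vectors, m = 0,
    using [treeR_free]. *)
Lemma q6j_val (N : nat) (c : nat -> nat -> R[i]) :
  let mu := mu1 + mu2 + mu3 - N%:R in
  (forall p a1 a2 a3, treeL h Delta mu1 mu2 mu3 (mu1 + mu2 - p%:R) mu a1 a2 a3 =
    \sum_(k < N.+1)
      c p k * treeR h Delta mu1 mu2 mu3 (mu2 + mu3 - k%:R) mu a1 a2 a3) ->
  forall p k, (p <= N)%N -> (k <= N)%N ->
  q6j h Delta mu1 mu2 (mu1 + mu2 - p%:R) mu3 mu (mu2 + mu3 - k%:R) = c p k.
Proof.
move=> mu cP p k lep lek; rewrite /q6j.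
have -> : mu1 + mu2 - (mu1 + mu2 - p%:R) = p%:R by ring.
have -> : mu1 + mu2 - p%:R + mu3 - mu = (N - p)%:R.
  by rewrite /mu (natrB _ lep); ring.
have -> : mu2 + mu3 - (mu2 + mu3 - k%:R) = k%:R by ring.
have -> : mu1 + (mu2 + mu3 - k%:R) - mu = (N - k)%:R.
  by rewrite /mu (natrB _ lek); ring.
rewrite !isnat_nat /=.
have EN : natC (mu1 + mu2 + mu3 - mu) = N by rewrite /mu subKr natC_nat.
set S := [set x | _]%classic.
have Sc : S (c p k).
  (* Coefficient families are indexed by the weight mu23, from which [natC] recovers the index k. *)
  exists (fun x => c p (natC (mu2 + mu3 - x))); last by rewrite subKr natC_nat.
  move=> m; rewrite EN /=; apply/malgP => -[[n1 n2] n3].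
  rewrite raddf_sum e12_coef /=.
  have [e|ne] := eqVneq (mu1 + mu2 + mu3 - (mu - m%:R)) (n1 + n2 + n3)%:R.
    rewrite cP; apply: eq_bigr => l _.
    by rewrite mcoeffZ e23_coef e eqxx subKr natC_nat.
  by rewrite big1 // => l _; rewrite mcoeffZ e23_coef (negbTE ne) mulr0.
have [c' c'P ->] := xgetI 0 Sc.
apply/eqP; rewrite -subr_eq0; apply/eqP.
apply: (treeR_free q_gen DeltaP (N := N) g1 g2 g3 g23 g123
  (d := fun k => c' (mu2 + mu3 - k%:R) - c p k)) => // i j l ijl.
have := congr1 (mcoeff (i, j, l)) (c'P 0); rewrite EN /= e12_coef raddf_sum /=.
have e0 : mu1 + mu2 + mu3 - (mu - 0%:R) == (i + j + l)%:R.
  by rewrite ijl /mu subr0 subKr.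
rewrite e0 cP => e.
under eq_bigr do rewrite mulrBl.
rewrite sumrB e; apply/eqP; rewrite subr_eq0; apply/eqP.
by apply: eq_bigr => q _; rewrite mcoeffZ e23_coef e0.
Qed.

(** Regrouping in a form that can be chained. The offset s lets the new weight be counted from X
    instead of mu1 + mu2, and M pads the range; the added terms vanish by the zero convention for
    6j-symbols, and an inadmissible mu23 makes both sides zero. *)
Lemma treeR_expand (X mu mu23 : R[i]) (s N0 M : nat) :
  X = mu1 + mu2 + s%:R -> X + mu3 - mu = N0%:R -> (N0 <= M)%N ->
  forall a1 a2 a3,
  treeR h Delta mu1 mu2 mu3 mu23 mu a1 a2 a3 =
  \sum_(p < M.+1) q6j h Delta mu1 mu2 (X - p%:R) mu3 mu mu23
    * treeL h Delta mu1 mu2 mu3 (X - p%:R) mu a1 a2 a3.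
Proof.
move=> EX EN0 leM a1 a2 a3.
have [/isnatP[q Eq]|nq] := boolP (isnat (mu2 + mu3 - mu23)); last first.
  rewrite /treeR (wt3j_eq0J _ _ _ _ nq) mulr0 big1 // => p _.
  by rewrite /q6j (negbTE nq) /= !andbF mul0r.
have [/isnatP[r Er]|nr] := boolP (isnat (mu1 + mu23 - mu)); last first.
  rewrite /treeR (wt3j_eq0J _ _ _ _ nr) mul0r big1 // => p _.
  by rewrite /q6j (negbTE nr) /= !andbF mul0r.
have E23 : mu23 = mu2 + mu3 - q%:R by rewrite -Eq; ring.
have Emu : mu = mu1 + mu2 + mu3 - (q + r)%:R.
  by rewrite natrD -Eq -Er; ring.
have eN0 : (s + (q + r) = N0)%N.
  by apply: (@natrI R); rewrite natrD -EN0 EX Emu; ring.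
have [c cP] := choice (recoupling_ex q_gen DeltaP (q + r) g1 g2 g3 g12 g23 g123).
rewrite (@sum_shift _ s (q + r) M (fun p => q6j h Delta mu1 mu2 (X - p%:R) mu3 mu mu23
    * treeL h Delta mu1 mu2 mu3 (X - p%:R) mu a1 a2 a3)) ?eN0 //.
- rewrite E23 Emu (recoupling_inv q_gen DeltaP g1 g2 g3 g12 g23 g123 cP) ?leq_addr //.
  apply: eq_bigr => p _.
  have -> : X - (s + p)%:R = mu1 + mu2 - p%:R by rewrite EX natrD; ring.
  by rewrite (q6j_val cP) ?leq_addr // -ltnS.
- move=> p lt; rewrite /q6j ifF ?mul0r //; apply/negbTE.
  have -> : mu1 + mu2 - (X - p%:R) = p%:R - s%:R by rewrite EX; ring.
  by apply/negP => /andP[/isnat_subn]; rewrite leqNgt lt.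
move=> p lt; rewrite /q6j ifF ?mul0r //; apply/negbTE.
have -> : X - p%:R + mu3 - mu = N0%:R - p%:R by rewrite -EN0; ring.
by apply/negP => /and3P[_ /isnat_subn]; rewrite leqNgt lt.
Qed.

End Values.
End SixJ.

(** * The two regroupings of the fourfold tree *)

Section FourFold.
Variables (R : realType) (h : R[i]) (Delta : R[i] -> R[i] -> R[i] -> R[i]).
Hypothesis q_gen : forall n : nat, qnum h n.+1%:R != 0.
Hypothesis DeltaP : Delta_choice h Delta.
Local Notation qp := (qpow h).
Local Notation G := (wt3j h Delta).
Local Notation sixj := (q6j h Delta).
Implicit Types (a : R[i]).

(** Pairing with the k-th symbol recovers y k. The bound k <= p appears because a summand with k > p
    has no vector at depth p. *)
Lemma nat3j_free mu1 mu2 (p M : nat) (y : nat -> R[i]) :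
  generic_weight h mu1 -> generic_weight h mu2 -> generic_weight h (mu1 + mu2) ->
  (forall x : nat, (x <= p)%N ->
    \sum_(k < M) y k * nat3j h Delta mu1 mu2 k x (p - x) = 0) ->
  forall k, (k < M)%N -> (k <= p)%N -> y k = 0.
Proof.
move=> g1 g2 g12 y0 k ltk lek.
have : \sum_(l < M) y l * dot2 h mu1 mu2 p (nat3j h Delta mu1 mu2 l)
    (nat3j h Delta mu1 mu2 k) = 0.
  rewrite /dot2; under eq_bigr do rewrite mulr_sumr.
  rewrite exchange_big big1 //= => x _.
  have lex : (x <= p)%N by rewrite -ltnS.
  transitivity (vnorm h mu1 x * vnorm h mu2 (p - x) *
    nat3j h Delta mu1 mu2 k x (p - x) *
    \sum_(l < M) y l * nat3j h Delta mu1 mu2 l x (p - x)).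
    by rewrite mulr_sumr; apply: eq_bigr => l _; ring.
  by rewrite (y0 _ lex) mulr0.
rewrite (bigD1 (Ordinal ltk)) //= (orth2 q_gen DeltaP) // eqxx lek /=.
rewrite big1 ?addr0 => [e|l ne].
  apply: (mulIf (vnorm_neq0 q_gen (p - k) (generic_weightB k g12))).
  by rewrite mul0r.
rewrite (orth2 q_gen DeltaP) // ifF ?mulr0 //.
by apply: contraNF ne => /andP[/eqP e _]; apply/eqP/val_inj.
Qed.

(** The part of the exchange scalar that is independent of the vector: the eigenvalue of the
    braiding on the summand M_mu, a sign times q to a difference of Casimir values. *)
Definition flip_phase m1 nu mu : R[i] :=
  m1pow (m1 + nu - mu) * qp (mu * (mu + 1) - m1 * (m1 + 1) - nu * (nu + 1)).

Lemma flip_phase_neq0 m1 nu mu : flip_phase m1 nu mu != 0.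
Proof. exact: mulf_neq0 (m1pow_neq0 _) (qpow_neq0 _ _). Qed.

Lemma wt3j_flipr m1 nu mu a : G nu m1 mu a m1 =
  flip_phase m1 nu mu * qp (- (2%:R * m1 * a)) * G m1 nu mu m1 a.
Proof. by rewrite (wt3j_flip h (proj2 DeltaP)) qpowD !mulrA. Qed.

Lemma wt3j_flipl m1 nu mu a : G m1 nu mu m1 a =
  (flip_phase m1 nu mu)^-1 * qp (2%:R * m1 * a) * G nu m1 mu a m1.
Proof.
rewrite wt3j_flipr qpowN.
have f0 := flip_phase_neq0 m1 nu mu; have p0 := qpow_neq0 h (2%:R * m1 * a).
by field; rewrite f0 p0.
Qed.

Variables l1 l2 l3 l4 l23 l123 l1234 : R[i].
Variables k23 J1 J3 : nat.
Hypotheses (E23 : l23 = l2 + l3 - k23%:R) (E123 : l123 = l1 + l23 - J1%:R).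
Hypothesis E1234 : l1234 = l4 + l123 - J3%:R.
Hypotheses (g1 : generic_weight h l1) (g2 : generic_weight h l2).
Hypotheses (g3 : generic_weight h l3) (g4 : generic_weight h l4).
Hypothesis g12 : generic_weight h (l1 + l2).
Hypotheses (g23 : generic_weight h (l2 + l3)) (g24 : generic_weight h (l2 + l4)).
Hypothesis g123 : generic_weight h (l1 + l2 + l3).
Hypothesis g124 : generic_weight h (l1 + l2 + l4).
Hypothesis g234 : generic_weight h (l2 + l3 + l4).
Hypothesis g1234 : generic_weight h (l1 + l2 + l3 + l4).

Let N := (k23 + J1 + J3)%N.
Let al j := l1 + l2 - j%:R.
Let be b := l2 + l3 + l4 - b%:R.
Let m124 i := l1 + l2 + l4 - i%:R.
Let m24 k := l2 + l4 - k%:R.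

Let W i k a4 a2 a3 := G (m124 i) l3 l1234 (a4 + a2 + l1) a3 *
  (G (m24 k) l1 (m124 i) (a4 + a2) l1 * G l4 l2 (m24 k) a4 a2).

(* The tree (4(1(23))) with the factor of weight [l1] at its highest weight. *)
Let U a4 a2 a3 := G l4 l123 l1234 a4 (l1 + (a2 + a3)) *
  (G l1 l23 l123 l1 (a2 + a3) * G l2 l3 l23 a2 a3).

Let cL i k j := sixj l1 l2 (al j) l3 l123 l23 * sixj l4 (al j) (m124 i) l3 l1234 l123
  * sixj l4 l2 (m24 k) l1 (m124 i) (al j) / flip_phase l1 l2 (al j).

(** Moving 1 to the right past (23) and past (42) contributes inverse phases, moving it back past
    ((42)3) a direct one. *)
Let cR i k b := sixj l4 l23 (be b) l1 l1234 l123 * sixj l4 l2 (m24 k) l3 (be b) l23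
  * sixj l1 (m24 k) (m124 i) l3 l1234 (be b)
  * (flip_phase l1 (be b) l1234 / flip_phase l1 l23 l123
     / flip_phase l1 (m24 k) (m124 i)).

Let gB (x y : R[i]) (n : nat) : generic_weight h x -> y = x - n%:R ->
  generic_weight h y.
Proof. by move=> g ->; exact: generic_weightB. Qed.

Let sum_perm (X : nat -> nat -> nat -> R[i]) (M : nat) :
  \sum_(j < M) \sum_(i < M) \sum_(k < M) X i k j =
  \sum_(i < M) \sum_(k < M) \sum_(j < M) X i k j.
Proof.
rewrite exchange_big; apply: eq_bigr => i _; exact: exchange_big.
Qed.

(** The moves are 4(1(23)) -> 4((12)3) -> (4(12))3 -> (4(21))3 -> ((42)1)3, with new labels [al j],
    [m124 i], none, [m24 k]. *)
Lemma chainL a4 a2 a3 : U a4 a2 a3 = qp (2%:R * l1 * a2) *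
  \sum_(i < N.+1) \sum_(k < N.+1) (\sum_(j < N.+1) cL i k j) * W i k a4 a2 a3.
Proof.
transitivity (\sum_(j < N.+1) \sum_(i < N.+1) \sum_(k < N.+1)
  qp (2%:R * l1 * a2) * (cL i k j * W i k a4 a2 a3)); last first.
  rewrite (sum_perm (fun i k j => qp (2%:R * l1 * a2) * (cL i k j * W i k a4 a2 a3))).
  rewrite mulr_sumr; apply: eq_bigr => i _; rewrite mulr_sumr; apply: eq_bigr => k _.
  by rewrite mulr_suml mulr_sumr.
rewrite /U -/(treeR h Delta l1 l2 l3 l23 l123 l1 a2 a3).
rewrite (@treeR_expand _ h Delta q_gen DeltaP l1 l2 l3 g1 g2 g3 g12 g23 g123
  (l1 + l2) l123 l23 0 (k23 + J1) N); first last.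
- by rewrite leq_addr.
- by rewrite E123 E23 natrD; ring.
- by rewrite addr0.
rewrite mulr_sumr; apply: eq_bigr => j _; rewrite -/(al j) /treeL.
transitivity (sixj l1 l2 (al j) l3 l123 l23 * G l1 l2 (al j) l1 a2 *
    treeR h Delta l4 (al j) l3 l123 l1234 a4 (l1 + a2) a3).
  by rewrite /treeR -(addrA l1); ring.
rewrite (@treeR_expand _ h Delta q_gen DeltaP l4 (al j) l3 g4 _ g3 _ _ _
  (l1 + l2 + l4) l1234 l123 j N N) //; first last.
- by rewrite E1234 E123 E23 /N !natrD; ring.
- by rewrite /al; ring.
- by apply: (gB (n := j) g1234); rewrite /al; ring.
- by apply: (gB (n := j) g123); rewrite /al; ring.
- by apply: (gB (n := j) g124); rewrite /al; ring.
- by apply: (gB (n := j) g12).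
rewrite mulr_sumr; apply: eq_bigr => i _; rewrite -/(m124 i) /treeL.
transitivity (sixj l1 l2 (al j) l3 l123 l23 * sixj l4 (al j) (m124 i) l3 l1234 l123
  * ((flip_phase l1 l2 (al j))^-1 * qp (2%:R * l1 * a2))
  * G (m124 i) l3 l1234 (a4 + a2 + l1) a3 *
    treeR h Delta l4 l2 l1 (al j) (m124 i) a4 a2 l1).
  rewrite wt3j_flipl /treeR (addrC a2 l1).
  have -> : a4 + (l1 + a2) = a4 + a2 + l1 by ring.
  by ring.
rewrite (@treeR_expand _ h Delta q_gen DeltaP l4 l2 l1 g4 g2 g1 _ _ _
  (l2 + l4) (m124 i) (al j) 0 i N); first last.
- by rewrite -ltnS.
- by rewrite /m124; ring.
- by ring.
- by apply: (gB (n := 0) g124); ring.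
- by rewrite addrC.
- by rewrite addrC.
rewrite mulr_sumr; apply: eq_bigr => k _; rewrite -/(m24 k) /treeL /cL /W.
move: (flip_phase _ _ _)^-1 => f; ring.
Qed.

(** The moves are 4(1(23)) -> 4((23)1) -> (4(23))1 -> ((42)3)1 -> 1((42)3) -> (1(42))3 -> ((42)1)3;
    the regroupings introduce [be b], [m24 k] and [m124 i]. *)
Lemma chainR a4 a2 a3 : U a4 a2 a3 = qp (2%:R * l1 * a2) *
  \sum_(i < N.+1) \sum_(k < N.+1) (\sum_(b < N.+1) cR i k b) * W i k a4 a2 a3.
Proof.
transitivity (\sum_(b < N.+1) \sum_(k < N.+1) \sum_(i < N.+1)
  qp (2%:R * l1 * a2) * (cR i k b * W i k a4 a2 a3)); last first.
  rewrite (sum_perm (fun k i b => qp (2%:R * l1 * a2) * (cR i k b * W i k a4 a2 a3))).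
  rewrite [LHS]exchange_big /=.
  rewrite mulr_sumr; apply: eq_bigr => i _; rewrite mulr_sumr; apply: eq_bigr => k _.
  by rewrite mulr_suml mulr_sumr.
rewrite /U wt3j_flipl.
transitivity ((flip_phase l1 l23 l123)^-1 * qp (2%:R * l1 * (a2 + a3))
   * G l2 l3 l23 a2 a3 * treeR h Delta l4 l23 l1 l123 l1234 a4 (a2 + a3) l1).
  by rewrite /treeR (addrC (a2 + a3)); ring.
rewrite (@treeR_expand _ h Delta q_gen DeltaP l4 l23 l1 g4 _ g1 _ _ _
  (l2 + l3 + l4) l1234 l123 k23 N N) //; first last.
- by rewrite E1234 E123 E23 /N !natrD; ring.
- by rewrite E23; ring.
- by apply: (gB (n := k23) g1234); rewrite E23; ring.
- by apply: (gB (n := k23) g123); rewrite E23; ring.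
- by apply: (gB (n := k23) g234); rewrite E23; ring.
- by apply: (gB (n := k23) g23).
rewrite mulr_sumr; apply: eq_bigr => b _; rewrite -/(be b) /treeL.
transitivity (sixj l4 l23 (be b) l1 l1234 l123 * G (be b) l1 l1234 (a4 + (a2 + a3)) l1
  * ((flip_phase l1 l23 l123)^-1 * qp (2%:R * l1 * (a2 + a3)))
  * treeR h Delta l4 l2 l3 l23 (be b) a4 a2 a3).
  by rewrite /treeR; ring.
rewrite (@treeR_expand _ h Delta q_gen DeltaP l4 l2 l3 g4 g2 g3 _ g23 _
  (l2 + l4) (be b) l23 0 b N); first last.
- by rewrite -ltnS.
- by rewrite /be; ring.
- by ring.
- by apply: (gB (n := 0) g234); ring.
- by rewrite addrC.
rewrite mulr_sumr; apply: eq_bigr => k _; rewrite -/(m24 k) /treeL.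
rewrite wt3j_flipr.
transitivity (sixj l4 l23 (be b) l1 l1234 l123 * sixj l4 l2 (m24 k) l3 (be b) l23
  * (flip_phase l1 (be b) l1234 / flip_phase l1 l23 l123
     * (qp (- (2%:R * l1 * (a4 + (a2 + a3)))) * qp (2%:R * l1 * (a2 + a3))))
  * G l4 l2 (m24 k) a4 a2
  * treeR h Delta l1 (m24 k) l3 (be b) l1234 l1 (a4 + a2) a3).
  by rewrite /treeR -(addrA a4); move: (flip_phase _ _ _)^-1 => f; ring.
rewrite (@treeR_expand _ h Delta q_gen DeltaP l1 (m24 k) l3 g1 _ g3 _ _ _
  (l1 + l2 + l4) l1234 (be b) k N N) //; first last.
- by rewrite E1234 E123 E23 /N !natrD; ring.
- by rewrite /m24; ring.
- by apply: (gB (n := k) g1234); rewrite /m24; ring.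
- by apply: (gB (n := k) g234); rewrite /m24; ring.
- by apply: (gB (n := k) g124); rewrite /m24; ring.
- by apply: (gB (n := k) g24).
rewrite mulr_sumr; apply: eq_bigr => i _; rewrite -/(m124 i) /treeL.
rewrite wt3j_flipl /cR /W (addrC l1 (a4 + a2)).
have -> : qp (2%:R * l1 * a2) = qp (- (2%:R * l1 * (a4 + (a2 + a3))))
    * qp (2%:R * l1 * (a2 + a3)) * qp (2%:R * l1 * (a4 + a2)).
  by rewrite -!qpowD; congr qp; ring.
move: (flip_phase l1 (m24 k) (m124 i))^-1 (flip_phase l1 l23 l123)^-1 => f f'.
ring.
Qed.

(** Orthogonality in the tensor product of M_l4 and M_l2 isolates one value k0 of k. This leaves a
    combination f of trees on the weights [m24 k0], l1, l3 that vanishes when its middle factor is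
    highest, hence everywhere below by [E_eigen_mid], and [treeL_free] gives its coefficients. For k
    > i the tree W itself is zero, whence the restriction on the indices. *)
Lemma W_free (d : nat -> nat -> R[i]) :
  (forall a4 a2 a3,
    \sum_(i < N.+1) \sum_(k < N.+1) d i k * W i k a4 a2 a3 = 0) ->
  forall i k, (k <= i)%N -> (i <= N)%N -> d i k = 0.
Proof.
move=> d0 i0 k0 leki leiN.
have g42 : generic_weight h (l4 + l2) by rewrite addrC.
have gm24 : generic_weight h (m24 k0) by exact: (gB (n := k0) g24).
have EN : l1234 = m24 k0 + l1 + l3 - (N - k0)%:R.
  rewrite natrB ?(leq_trans leki leiN) // E1234 E123 E23 /m24 /N !natrD; ring.
pose f a a1 a3 := \sum_(i < N.+1) d i k0 *
   treeL h Delta (m24 k0) l1 l3 (m124 i) l1234 a a1 a3.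
have f0 a a3 : f a l1 a3 = 0.
  have [/isnatP[n En]|nn] := boolP (isnat (m24 k0 - a)); last first.
    rewrite /f big1 // => i _; rewrite /treeL (wt3j_eq0l _ _ _ _ _ nn).
    by rewrite !mulr0.
  (* Written as a function of k evaluated at k0, with a = l4 + l2 - (k0 + n), the sum is the
     coefficient of the k0-th 3j-symbol at depth k0 + n. *)
  have -> : f a l1 a3 = (fun k => \sum_(i < N.+1) d i k *
     (G (m124 i) l3 l1234 (l4 + l2 - (k0 + n)%:R + l1) a3 *
      G (m24 k) l1 (m124 i) (l4 + l2 - (k0 + n)%:R) l1)) k0.
    have -> : a = l4 + l2 - (k0 + n)%:R.
      by rewrite natrD -En /m24; ring.
    by [].
  apply: (nat3j_free (M := N.+1) (p := (k0 + n)%N) (y := (fun k => \sum_(i < N.+1) d i k *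
     (G (m124 i) l3 l1234 (l4 + l2 - (k0 + n)%:R + l1) a3 *
      G (m24 k) l1 (m124 i) (l4 + l2 - (k0 + n)%:R) l1))) g4 g2 g42);
    last by rewrite leq_addr.
    move=> x lex; rewrite -[RHS](d0 (l4 - x%:R) (l2 - (k0 + n - x)%N%:R) a3).
    rewrite [RHS]exchange_big /=; apply: eq_bigr => k _.
    rewrite mulr_suml; apply: eq_bigr => i _.
    have e42 : l4 - x%:R + (l2 - (k0 + n - x)%N%:R) = l4 + l2 - (k0 + n)%:R.
      by rewrite (natrB _ lex); ring.
    rewrite /W e42 /nat3j.
    have -> : l4 + l2 - k%:R = m24 k by rewrite /m24; ring.
    ring.
  by rewrite ltnS (leq_trans leki leiN).
have Ef : E_eigen h (m24 k0) l1 l3 l1234 (fun a a1 a3 => 0 - f a a1 a3).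
  apply: (@E_eigen_comb _ _ _ _ _ _ (fun _ _ _ => 0) N.+1 (fun i => d i k0)
    (fun i => treeL h Delta (m24 k0) l1 l3 (m124 i) l1234)).
    by move=> a1 a2 a3; rewrite !mulr0 !addr0.
  move=> i; apply: (treeL_E Delta q_gen).
    by apply: (gB (n := i) g124).
  by apply: (gB (n := N) g1234); rewrite E1234 E123 E23 /N !natrD; ring.
have fz n a a3 : f a (l1 - n%:R) a3 = 0.
  have z b1 b3 : 0 - f b1 l1 b3 = 0 by rewrite f0 subr0.
  have := E_eigen_mid q_gen n Ef z a a3.
  by rewrite sub0r => /eqP; rewrite oppr_eq0 => /eqP.
have -> : i0 = (k0 + (i0 - k0))%N by rewrite subnKC.
have ga : generic_weight h (m24 k0 + l1).
  by apply: (gB (n := k0) g124); rewrite /m24; ring.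
have gb : generic_weight h (m24 k0 + l1 + l3).
  by apply: (gB (n := k0) g1234); rewrite /m24; ring.
apply: (@treeL_free _ _ _ q_gen DeltaP (m24 k0) l1 l3 (N - k0) gm24 g1 g3 ga gb
  (fun p => d (k0 + p)%N k0)).
- move=> x y z xyz; rewrite -EN -[RHS](fz y (m24 k0 - x%:R) (l3 - z%:R)) /f.
  rewrite (@sum_shift _ k0 (N - k0) N (fun i => d i k0 *
    treeL h Delta (m24 k0) l1 l3 (m124 i) l1234 (m24 k0 - x%:R) (l1 - y%:R) (l3 - z%:R))).
  + apply: eq_bigr => p _.
    have -> // : m124 (k0 + p) = m24 k0 + l1 - p%:R.
    by rewrite /m124 /m24 natrD; ring.
  + by rewrite subnKC // (leq_trans leki leiN).
  + move=> p lt; rewrite /treeL (@wt3j_eq0J _ _ _ (m24 k0) l1 (m124 p)) ?mulr0 //.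
    have -> : m24 k0 + l1 - m124 p = p%:R - k0%:R by rewrite /m124 /m24; ring.
    by apply/negP => /isnat_subn; rewrite leqNgt lt.
  move=> p; rewrite subnKC ?(leq_trans leki leiN) // => lt.
  rewrite /treeL (@wt3j_eq0J _ _ _ (m124 p) l3 l1234) ?mul0r ?mulr0 //.
  have -> : m124 p + l3 - l1234 = N%:R - p%:R.
    by rewrite /m124 E1234 E123 E23 /N !natrD; ring.
  by apply/negP => /isnat_subn; rewrite leqNgt lt.
by rewrite leq_sub2r.
Qed.

Lemma star_triangle i k : (k <= i)%N -> (i <= k23 + J1 + J3)%N ->
  let l24 := l2 + l4 - k%:R in let l124 := l1 + l2 + l4 - i%:R in
  \sum_(j < (k23 + J1 + J3).+1)
    (let al := l1 + l2 - j%:R in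
     sixj l1 l2 al l3 l123 l23 * sixj l4 al l124 l3 l1234 l123
     * sixj l4 l2 l24 l1 l124 al / flip_phase l1 l2 al)
  = \sum_(b < (k23 + J1 + J3).+1)
    (let be := l2 + l3 + l4 - b%:R in
     sixj l4 l23 be l1 l1234 l123 * sixj l4 l2 l24 l3 be l23
     * sixj l1 l24 l124 l3 l1234 be
     * (flip_phase l1 be l1234 / flip_phase l1 l23 l123
        / flip_phase l1 l24 l124)).
Proof.
move=> leki leiN; apply/eqP; rewrite -subr_eq0; apply/eqP.
apply: (W_free (d := fun i k => \sum_(j < N.+1) cL i k j - \sum_(b < N.+1) cR i k b))
  leki leiN => a4 a2 a3.
have := etrans (esym (chainL a4 a2 a3)) (chainR a4 a2 a3).
move/(mulfI (qpow_neq0 h _)) => e.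
under eq_bigr do (under eq_bigr do rewrite mulrBl; rewrite sumrB).
by rewrite sumrB e subrr.
Qed.

End FourFold.

(** * Consequences of genericity and the comparison of phases *)

Section Genericity.
Variables (R : realType) (h : R[i]).

Lemma generic_q_nat (lam : 'I_4 -> R[i]) : generic_q h lam ->
  forall n : nat, qnum h n.+1%:R != 0.
Proof.
move=> g n; have := g (Posz n.+1) (fun=> 0).
rewrite /= big1 ?addr0 => [|i _]; last by rewrite mulr0z mulr0 mul0r.
by apply; rewrite pnatr_eq0.
Qed.

(** Twice the partial sum minus n lies in the lattice of [generic_q], and it is nonzero because the
    partial sum is not n/2. *)
Lemma generic_q_weight (lam : 'I_4 -> R[i]) (I : {set 'I_4}) :
  generic_q h lam ->
  (forall n : nat, \sum_(i in I) lam i != n%:R / 2%:R) ->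
  generic_weight h (\sum_(i in I) lam i).
Proof.
move=> g nI n; set S := \sum_(i in I) lam i.
have := g (- Posz n) (fun i => if i \in I then 1 else 0); rewrite /=.
have -> : (- Posz n)%:~R + \sum_i (2%:R * (if i \in I then 1 else 0)%:~R * lam i)
    = 2%:R * S - n%:R.
  rewrite rmorphN /= addrC; congr (_ - _).
  rewrite /S mulr_sumr [RHS]big_mkcond /=; apply: eq_bigr => i _.
  by case: (i \in I); rewrite ?mulr1 // mulr0 mul0r.
apply; apply: contra (nI n); rewrite subr_eq0 -/S => /eqP <-.
by rewrite mulrC mulKf // pnatr_eq0.
Qed.

Lemma generic_tuple4 (l1 l2 l3 l4 : R[i]) (b1 b2 b3 b4 : bool) :
  let lam := tnth [tuple l1; l2; l3; l4] in
  generic_q h lam ->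
  (forall I : {set 'I_4}, I != set0 ->
     forall n : nat, \sum_(i in I) lam i != n%:R / 2%:R) ->
  [|| b1, b2, b3 | b4] ->
  generic_weight h ((if b1 then l1 else 0) + ((if b2 then l2 else 0)
    + ((if b3 then l3 else 0) + (if b4 then l4 else 0)))).
Proof.
move=> lam gq gI b; pose I := [set i : 'I_4 | nth false [:: b1; b2; b3; b4] i].
have SI : \sum_(i in I) lam i = (if b1 then l1 else 0) + ((if b2 then l2 else 0)
    + ((if b3 then l3 else 0) + (if b4 then l4 else 0))).
  by rewrite big_mkcond !big_ord_recl big_ord0 /= !inE /= addr0 /lam
    !(tnth_nth 0) /=.
rewrite -SI; apply: generic_q_weight => //; apply: gI.
apply/set0Pn; case/or4P: b => e.
- by exists (inord 0); rewrite inE inordK //= e.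
- by exists (inord 1); rewrite inE inordK //= e.
- by exists (inord 2); rewrite inE inordK //= e.
- by exists (inord 3); rewrite inE inordK //= e.
Qed.

(** Complex powers of -1 are not invariant under a change of sign of the exponent; the signs of the
    theorem and those of [flip_phase] agree because their exponents differ by even integers. *)
Lemma m1pow_even (z w : R[i]) (m n : nat) :
  z - w = 2%:R * (m%:R - n%:R) -> m1pow z = m1pow w.
Proof.
move=> e; have -> : z = w + (2 * m)%:R - (2 * n)%:R.
  by rewrite -[z](subrK w) e !natrM; ring.
by rewrite !m1powD m1powN !m1pow_nat !exprM sqrrN !expr1n invr1 !mulr1.
Qed.

End Genericity.

Theorem theorem6p6 (R : realType) (h : R[i])
    (Delta : R[i] -> R[i] -> R[i] -> R[i])
    (l1 l2 l3 l4 l23 l24 l123 l124 l1234 : R[i]) :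
  let lam := tnth [tuple l1; l2; l3; l4] in
  let C := fun l : R[i] => l * (l + 1) in
  let sixj := q6j h Delta in
  Delta_choice h Delta ->
  generic_q h lam ->
  (forall I : {set 'I_4}, I != set0 ->
     forall n : nat, \sum_(i in I) lam i != n%:R / 2%:R) ->
  isnat (l2 + l3 - l23) ->
  isnat (l2 + l4 - l24) ->
  isnat (l1 + l23 - l123) ->
  isnat (l1 + l24 - l124) ->
  isnat (l4 + l123 - l1234) ->
  isnat (l3 + l124 - l1234) ->
  \sum_(j < (minn (natC (l1 + l2 + l3 - l123))
                  (natC (l1 + l2 + l4 - l124))).+1)
    (let al := l1 + l2 - j%:R in
     m1pow (- al + l2 - l23 - l24)
     * qpow h (- (al * (al + 1)) + C l2 - C l23 - C l24)
     * sixj l1 l2 al l3 l123 l23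
     * sixj l4 al l124 l3 l1234 l123
     * sixj l4 l2 l24 l1 l124 al)
  =
  \sum_(k < (natC (l1 + l2 + l3 + l4 - l1234)).+1)
    (let be := l2 + l3 + l4 - k%:R in
     m1pow (- be + l1234 - l123 - l124)
     * qpow h (- (be * (be + 1)) + C l1234 - C l123 - C l124)
     * sixj l4 l23 be l1 l1234 l123
     * sixj l4 l2 l24 l3 be l23
     * sixj l1 l24 l124 l3 l1234 be).
Proof.
move=> lam C sixj DeltaP gq gI /isnatP[k23 e23] /isnatP[k24 e24] /isnatP[J1 e1]
  /isnatP[J2 e2] /isnatP[J3 e3] /isnatP[J4 e4].
have q_gen := generic_q_nat gq.
(* The four booleans select the subset of the l's whose sum is x. *)
have gen b1 b2 b3 b4 b x : x = _ -> generic_weight h x :=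
  fun e : x = _ => eq_ind_r _ (@generic_tuple4 _ _ l1 l2 l3 l4 b1 b2 b3 b4 gq gI b) e.
have E23 : l23 = l2 + l3 - k23%:R by rewrite -e23; ring.
have E24 : l24 = l2 + l4 - k24%:R by rewrite -e24; ring.
have E123 : l123 = l1 + l23 - J1%:R by rewrite -e1; ring.
have E124' : l124 = l1 + l24 - J2%:R by rewrite -e2; ring.
have E124 : l124 = l1 + l2 + l4 - (k24 + J2)%:R.
  by rewrite E124' E24 natrD; ring.
have E1234 : l1234 = l4 + l123 - J3%:R by rewrite -e3; ring.
have eN : (k23 + J1 + J3 = k24 + J2 + J4)%N.
  by apply: (@natrI R); rewrite !natrD -e23 -e24 -e1 -e2 -e3 -e4; ring.
have -> : natC (l1 + l2 + l3 + l4 - l1234) = (k23 + J1 + J3)%N.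
  rewrite -[RHS](natC_nat R) E1234 E123 E23; congr natC; rewrite !natrD; ring.
have -> : natC (l1 + l2 + l3 - l123) = (k23 + J1)%N.
  rewrite -[RHS](natC_nat R) E123 E23; congr natC; rewrite !natrD; ring.
have -> : natC (l1 + l2 + l4 - l124) = (k24 + J2)%N.
  rewrite -[RHS](natC_nat R) E124; congr natC; ring.
have leN : (k24 + J2 <= k23 + J1 + J3)%N by rewrite eN leq_addr.
have := @star_triangle _ h Delta q_gen DeltaP l1 l2 l3 l4 l23 l123 l1234 k23 J1 J3
  E23 E123 E1234 _ _ _ _ _ _ _ _ _ _ _ (k24 + J2)%N k24 (leq_addr _ _) leN.
rewrite /= -E24 -E124 => st.
have {}st := st (gen true false false false isT l1 ltac:(rewrite /=; ring))
  (gen false true false false isT l2 ltac:(rewrite /=; ring))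
  (gen false false true false isT l3 ltac:(rewrite /=; ring))
  (gen false false false true isT l4 ltac:(rewrite /=; ring))
  (gen true true false false isT (l1 + l2) ltac:(rewrite /=; ring))
  (gen false true true false isT (l2 + l3) ltac:(rewrite /=; ring))
  (gen false true false true isT (l2 + l4) ltac:(rewrite /=; ring))
  (gen true true true false isT (l1 + l2 + l3) ltac:(rewrite /=; ring))
  (gen true true false true isT (l1 + l2 + l4) ltac:(rewrite /=; ring))
  (gen false true true true isT (l2 + l3 + l4) ltac:(rewrite /=; ring))
  (gen true true true true isT (l1 + l2 + l3 + l4) ltac:(rewrite /=; ring)).
(* The constant that turns [1 / flip_phase l1 l2 al] into the coefficient of the left sum; the same
   constant fits the three phases on the right. *)
pose K := m1pow (- (l1 + l23 + l24)) * qpow h (- C l1 - C l23 - C l24).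
pose F j := let al := l1 + l2 - j%:R in
     m1pow (- al + l2 - l23 - l24)
     * qpow h (- (al * (al + 1)) + C l2 - C l23 - C l24)
     * sixj l1 l2 al l3 l123 l23
     * sixj l4 al l124 l3 l1234 l123
     * sixj l4 l2 l24 l1 l124 al.
(* Past either bound in the minimum one of the first two 6j-symbols is zero, so the left sum extends
   to the common range. *)
transitivity (\sum_(j < (k23 + J1 + J3).+1) F j).
  have le : (0 + minn (k23 + J1) (k24 + J2) <= k23 + J1 + J3)%N.
    by rewrite add0n (leq_trans (geq_minr _ _)).
  rewrite (sum_shift (F := F) le) //.
  move=> p; rewrite add0n gtn_min /F => /orP[lt|lt].
    rewrite /= /sixj {1}/q6j ifF ?mulr0 ?mul0r //; apply/negbTE.
    have -> : l1 + l2 - p%:R + l3 - l123 = (k23 + J1)%:R - p%:R.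
      by rewrite E123 E23 natrD; ring.
    by apply/negP => /and3P[_ /isnat_subn]; rewrite leqNgt lt.
  rewrite /= /sixj {2}/q6j ifF ?mulr0 ?mul0r //; apply/negbTE.
  have -> : l4 + (l1 + l2 - p%:R) - l124 = (k24 + J2)%:R - p%:R.
    by rewrite E124; ring.
  by apply/negP => /and3P[/isnat_subn]; rewrite leqNgt lt.
transitivity (K * \sum_(j < (k23 + J1 + J3).+1)
    (q6j h Delta l1 l2 (l1 + l2 - j%:R) l3 l123 l23
     * q6j h Delta l4 (l1 + l2 - j%:R) l124 l3 l1234 l123
     * q6j h Delta l4 l2 l24 l1 l124 (l1 + l2 - j%:R)
     / flip_phase h l1 l2 (l1 + l2 - j%:R))).
  rewrite mulr_sumr; apply: eq_bigr => j _; rewrite /F /sixj /=.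
  set a := l1 + l2 - j%:R.
  have -> : m1pow (- a + l2 - l23 - l24) =
      m1pow (- (l1 + l23 + l24)) * (m1pow (l1 + l2 - a))^-1.
    rewrite -m1powN -m1powD; apply: (@m1pow_even _ _ _ j 0).
    by rewrite /a; ring.
  have -> : qpow h (- (a * (a + 1)) + C l2 - C l23 - C l24) =
      qpow h (- C l1 - C l23 - C l24)
      * (qpow h (a * (a + 1) - l1 * (l1 + 1) - l2 * (l2 + 1)))^-1.
    by rewrite -qpowN -qpowD; congr qpow; rewrite /C; ring.
  rewrite /flip_phase invfM /K.
  move: (m1pow _)^-1 (qpow _ _)^-1 => f f'; ring.
rewrite st mulr_sumr; apply: eq_bigr => b _; rewrite /sixj /=.
set be := l2 + l3 + l4 - b%:R.
have -> : m1pow (- be + l1234 - l123 - l124) = m1pow (- (l1 + l23 + l24)) *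
    (m1pow (l1 + be - l1234) * (m1pow (l1 + l23 - l123))^-1
     * (m1pow (l1 + l24 - l124))^-1).
  rewrite -!m1powN -!m1powD.
  apply: (@m1pow_even _ _ _ (J1 + J2 + b) (k23 + J1 + J3)).
  by rewrite /be E1234 E123 E124' E23 E24 !natrD; ring.
have -> : qpow h (- (be * (be + 1)) + C l1234 - C l123 - C l124) =
    qpow h (- C l1 - C l23 - C l24) *
    (qpow h (l1234 * (l1234 + 1) - l1 * (l1 + 1) - be * (be + 1))
     * (qpow h (l123 * (l123 + 1) - l1 * (l1 + 1) - l23 * (l23 + 1)))^-1
     * (qpow h (l124 * (l124 + 1) - l1 * (l1 + 1) - l24 * (l24 + 1)))^-1).
  by rewrite -!qpowN -!qpowD; congr qpow; rewrite /C; ring.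
rewrite /flip_phase !invfM /K.
move: (m1pow (l1 + l23 - l123))^-1 (m1pow (l1 + l24 - l124))^-1 => f1 f2.
move: (qpow h (l123 * _ - _ - _))^-1 (qpow h (l124 * _ - _ - _))^-1 => f3 f4.
ring.
Qed.
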